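(* Let $q\ge 2$. (a) Let $2\le k\le 2q-2$. For every $n$ with $n\ge 2q+1$ if $k$ is even, and $n\ge 2q+2$ if $k$ is odd, there is an $(n,q)$-cactus $Q$ with $\overrightarrow{rvc}(Q)=n-2q+k$. (b) Let $3\le k\le 3q-3$ with $k\ne 3q-4$. For every $n$ with $n\ge 2q+1$ if $k\equiv 0 \pmod 3$, $n\ge 2q+2$ if $k\equiv 1\pmod 3$, and $n\ge 2q+3$ if $k\equiv 2\pmod 3$, there is an $(n,q)$-cactus $Q$ with $\overrightarrow{trc}(Q)=2n-3q+k$. (c) For every $(n,q)$-cactus $Q$, $\overrightarrow{trc}(Q)\ne 2n-4$.
   Context: A cactus is a strongly connected oriented graph (finite, no loops, no multiple arcs, no pair of opposite arcs) in which every arc belongs to exactly one directed cycle; an $(n,q)$-cactus is a cactus with $n$ vertices and $q$ blocks (directed cycles). $\overrightarrow{rvc}(D)$ is the minimum number of colours in a vertex-colouring such that every ordered pair $(x,y)$ is joined by a directed path whose internal vertices have distinct colours. $\overrightarrow{trc}(D)$ is the minimum number of colours in a total-colouring (of vertices and arcs) such that every ordered pair is joined by a directed path whose arcs and internal vertices all receive pairwise distinct colours. *)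

(* Defs.v *)
From mathcomp Require Import all_boot.
From mathcomp Require Import boolp classical_sets.

Set Implicit Arguments.
Unset Strict Implicit.
Unset Printing Implicit Defensive.

(* The minimum of a set of naturals; it is 0 on the empty set, which
   [rvc_minimal] and [trc_minimal] below rule out where it is used. *)
Definition least (P : nat -> Prop) : nat :=
  xget 0 (fun m => P m /\ forall k, P k -> m <= k).

Definition oriented (T : finType) (e : rel T) : Prop :=
  irreflexive e /\ antisymmetric e.

Definition strongly_connected (T : finType) (e : rel T) : Prop :=
  forall x y, connect e x y.

Definition cycle_arcs (T : finType) (s : seq T) : {set T * T} :=
  [set (x, next s x) | x in s].

(* A directed cycle is a subgraph, so it is recorded by its set of arcs rather
   than by one of its rotations. A repetition-free s has size at most #|T|. *)
Definition dicycles (T : finType) (e : rel T) : {set {set T * T}} :=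
  [set cycle_arcs s | s : #|T|.-bseq T & (0 < size s) && ucycleb e s].

Definition cactus (T : finType) (e : rel T) : Prop :=
  [/\ strongly_connected e, oriented e &
      forall x y, e x y -> exists! C, C \in dicycles e /\ (x, y) \in C].

Definition nq_cactus (n q : nat) (T : finType) (e : rel T) : Prop :=
  [/\ cactus e, #|T| = n & #|dicycles e| = q].

(* The path visits x :: p; for x = y this is the trivial path p = [::]. *)
Definition dipath (T : finType) (e : rel T) (x y : T) (p : seq T) : Prop :=
  [/\ path e x p, last x p = y & uniq (x :: p)].

Definition internal (T : Type) (x : T) (p : seq T) : seq T :=
  behead (belast x p).

Definition rainbow_vertex_connected (T : finType) (e : rel T)
    (C : eqType) (c : T -> C) : Prop :=
  forall x y, exists2 p, dipath e x y p & uniq (map c (internal x p)).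

(* cv colours the vertices and ca the arcs; the values of ca on pairs that are
   not arcs play no role, and no colour is required to be used. *)
Definition total_rainbow_connected (T : finType) (e : rel T)
    (C : eqType) (cv : T -> C) (ca : T -> T -> C) : Prop :=
  forall x y, exists2 p, dipath e x y p &
    uniq (pairmap ca x p ++ map cv (internal x p)).

Definition rvc_colourable (T : finType) (e : rel T) (k : nat) : Prop :=
  exists c : T -> 'I_k, rainbow_vertex_connected e c.

Definition trc_colourable (T : finType) (e : rel T) (k : nat) : Prop :=
  exists (cv : T -> 'I_k) (ca : T -> T -> 'I_k), total_rainbow_connected e cv ca.

Definition rvc (T : finType) (e : rel T) : nat := least (rvc_colourable e).

Definition trc (T : finType) (e : rel T) : nat := least (trc_colourable e).

Lemma leastP (P : nat -> Prop) :
  (exists k, P k) -> P (least P) /\ forall k, P k -> least P <= k.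
Proof.
move=> [k0 Pk0].
have exb : exists k, `[< P k >] by exists k0; apply/asboolP.
have [m /asboolP Pm minm] := ex_minnP exb.
rewrite /least; case: xgetP => [y _ //|/(_ m) []].
by split=> // k Pk; apply: minm; apply/asboolP.
Qed.

Lemma strong_dipath (T : finType) (e : rel T) (x y : T) :
  strongly_connected e -> exists p, dipath e x y p.
Proof.
move=> /(_ x y) /connectP [p ep ->].
by case/shortenP: ep => p' ep' up' _; exists p'.
Qed.

Lemma uniq_internal (T : finType) (x : T) (p : seq T) :
  uniq (x :: p) -> uniq (internal x p).
Proof.
rewrite lastI rcons_uniq => /andP [_ ub]; rewrite /internal.
by case: (belast x p) ub => //= a s /andP [].
Qed.

Lemma rvc_minimal (T : finType) (e : rel T) : strongly_connected e ->
  rvc_colourable e (rvc e) /\ forall k, rvc_colourable e k -> rvc e <= k.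
Proof.
move=> sc; apply: leastP; exists #|T|, enum_rank => x y.
have [p pP] := strong_dipath x y sc; exists p => //.
by rewrite (map_inj_uniq enum_rank_inj); case: pP => _ _ /uniq_internal.
Qed.

Lemma uniq_pairmap_pair (T : finType) (x : T) (p : seq T) :
  uniq (x :: p) -> uniq (pairmap pair x p).
Proof.
elim: p x => //= y p IHp x /andP [xp yp]; rewrite (IHp _ yp) andbT.
have sub : forall z (s : seq T), {subset [seq a.1 | a <- pairmap pair z s] <= z :: s}.
  move=> z s; elim: s z => //= w s IHs z a; rewrite in_cons => /orP [/eqP ->|/IHs].
    by rewrite mem_head.
  by rewrite !in_cons => ->; rewrite orbT.
apply/negP => /(map_f fst) /sub /=.
by apply/negP.
Qed.

Lemma trc_minimal (T : finType) (e : rel T) : strongly_connected e ->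
  trc_colourable e (trc e) /\ forall k, trc_colourable e k -> trc e <= k.
Proof.
move=> sc; apply: leastP; exists #|{: T + T * T}|.
exists (fun x => enum_rank (inl x)), (fun x y => enum_rank (inr (x, y))) => x y.
have [p pP] := strong_dipath x y sc; exists p => //.
case: pP => _ _ up.
pose f (a : T * T) : T + T * T := inr a.
have -> : pairmap (fun x y => enum_rank (inr (x, y) : T + T * T)) x p =
          map enum_rank (map f (pairmap pair x p)).
  by elim: p x {up} => //= z s IHs x; rewrite IHs.
rewrite (map_comp enum_rank (@inl T (T * T))) -map_cat.
rewrite (map_inj_uniq enum_rank_inj) cat_uniq.
rewrite !map_inj_uniq ?uniq_pairmap_pair ?uniq_internal //; last 2 first.
- by move=> ? ? [].
- by move=> ? ? [].
rewrite andbT /=; apply/hasPn => z /mapP [a _ ->].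
by apply/negP => /mapP [].
Qed.

(* Main.v *)
(* In a cactus the dipath between two vertices is unique, so rvc and trc say which
   elements share a dipath.

   Colouring arcs by their tails, vertices u and v may share both their vertex
   colour and their tail colour as soon as neither of the dipaths u -> v, v -> u
   can be prolonged forwards ("dead ends"), and they may share their vertex colour
   as soon as neither can be prolonged backwards.  A Hamiltonian dipath forces
   trc >= 2n - 3.  Without one, let (w1, c1), (w2, c2) be disjoint leaf blocks with
   gates w_i, and p_i, s_i the predecessor and the successor of w_i.  Some maximal
   dipath from w1 ends at a vertex x different from p2, which is mergeable with p1;
   likewise some y is mergeable with p2; and p1, p2 are mergeable.  So two tail
   colours and two vertex colours are saved (even if x = y), and merging s1 with s2
   saves a third vertex colour, whence trc <= 2n - 5.

   For the existence statements start from a long cycle, glue on a chain of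
   triangles and of at most two 4-cycles, each attached at a gate of the previous
   block (consecutive gates are adjacent in a triangle and opposite in a 4-cycle),
   and finally d triangles at the last gate.  Compared with n vertex colours and n
   tail colours, a triangle of the chain saves nothing, a 4-cycle one vertex and one
   tail colour, each of the d final triangles two vertex colours and one tail
   colour.  The matching lower bounds come from a longest dipath together with the
   middle arcs of the final triangles. *)

Require Import Defs.
From mathcomp Require Import all_boot.
From mathcomp Require Import boolp zify.

Set Implicit Arguments.
Unset Strict Implicit.
Unset Printing Implicit Defensive.

(** * Cycles and uniqueness of dipaths *)

Section CycleArcs.

Variables (T : finType) (e : rel T).
Implicit Types (x y u v : T) (p c s : seq T) (C : {set T * T}).

(** The cycle is opened at [x]: [c] lists its other vertices in order, and [rcons c x] closes it
    up. *)
Definition dicycle x c := path e x (rcons c x) && uniq (x :: c).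

Lemma cycle_arcs_cons x c : uniq (x :: c) ->
  cycle_arcs (x :: c) =i pairmap pair x (rcons c x).
Proof.
move=> uc; set s := x :: c.
have nextE i : i < size s -> next s (nth x s i) = nth x c i.
  by move=> ltis; rewrite next_nth mem_nth // index_uniq.
suff <- : [seq (z, next s z) | z <- s] = pairmap pair x (rcons c x).
  move=> a; apply/imsetP/mapP => [] [z sz ->]; by exists z.
apply: (@eq_from_nth _ (x, x)) => [|i]; rewrite size_map ?size_pairmap ?size_rcons //.
move=> ltis; rewrite (nth_map x) // (nth_pairmap x) ?size_rcons //.
by rewrite nextE // -/(rcons c x) nth_rcons_default -rcons_cons nth_rcons ltis.
Qed.

Lemma dicyclesP C :
  reflect (exists x c, dicycle x c /\ C = cycle_arcs (x :: c)) (C \in dicycles e).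
Proof.
apply: (iffP imsetP) => [[s] | [x [c [/andP [ec uc] ->]]]].
  rewrite inE => /andP [s_gt0 /andP [es us]] ->.
  case: s s_gt0 es us => [[|x c] //= szs] _ es us; exists x, c; split=> //.
  by rewrite /dicycle es.
have szc : size (x :: c) <= #|T| by rewrite -(card_uniqP uc) max_card.
by exists (Bseq szc) => //; rewrite inE /ucycleb /= ec.
Qed.

Lemma cycle_arcs_rot n s : uniq s -> cycle_arcs (rot n s) = cycle_arcs s.
Proof.
move=> us; apply/setP => a.
by apply/imsetP/imsetP => [] [z sz ->]; exists z; rewrite ?next_rot // ?mem_rot // -(mem_rot n).
Qed.

Lemma dicycle_at C u v : C \in dicycles e -> (u, v) \in C ->
  exists c, [/\ dicycle u c, C = cycle_arcs (u :: c) & v = head u c].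
Proof.
move=> /dicyclesP [x [c [/andP [ec uc] ->]]] /imsetP [z sz [-> ->]] {u v}.
have [i s' rE] := rot_to sz.
have us' : uniq (z :: s') by rewrite -rE rot_uniq.
exists s'; split.
- by rewrite /dicycle us' andbT -[path _ _ _]/(cycle e (z :: s')) -rE rot_cycle.
- by rewrite -rE cycle_arcs_rot.
- have nz : next (z :: s') z = next (x :: c) z by rewrite -rE next_rot.
  by rewrite -[LHS]/(next (x :: c) z) -nz; case: (s') => [|b s''] /=; rewrite eqxx.
Qed.

Lemma mem_arc s u : u \in s -> (u, next s u) \in cycle_arcs s.
Proof. by move=> su; apply/imsetP; exists u. Qed.

Lemma cycle_arcs_mem s u v : (u, v) \in cycle_arcs s -> (u \in s) && (v \in s).
Proof. by move=> /imsetP [z sz [-> ->]]; rewrite mem_next sz. Qed.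

End CycleArcs.

Section UniqueDipaths.

Variables (T : finType) (e : rel T).
Implicit Types (x y u v : T) (p c s : seq T) (C : {set T * T}).

Definition unique_dipaths :=
  forall x y p q, dipath e x y p -> dipath e x y q -> p = q.

Hypothesis cactus_e : cactus e.

Lemma cactus_strong : strongly_connected e. Proof. by case: cactus_e. Qed.
Lemma cactus_irr x : e x x = false. Proof. by case: cactus_e => _ [->]. Qed.
Lemma cactus_asym x y : e x y -> e y x -> x = y.
Proof. by case: cactus_e => _ [_ asym] _ exy eyx; apply: asym; rewrite exy. Qed.

Lemma dicycle_unique C C' u v : C \in dicycles e -> C' \in dicycles e ->
  (u, v) \in C -> (u, v) \in C' -> C = C'.
Proof.
move=> dC dC' Cuv C'uv.
have euv : e u v.
  have [c [/andP [+ _] _ ->]] := dicycle_at dC Cuv.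
  by case: c => [|a c] /= /andP [].
case: cactus_e => _ _ /(_ u v euv) [D [_ Dun]].
by rewrite -(Dun C) // -(Dun C').
Qed.

Lemma arc_on_dicycle u v : e u v -> exists2 C, C \in dicycles e & (u, v) \in C.
Proof. by case: cactus_e => _ _ + euv => /(_ u v euv) [D [[]]]; exists D. Qed.

Definition off C : rel T := [rel u v | e u v && ((u, v) \notin C)].

(* A dipath off C between two vertices of C would close up, along an arc of C,
   to a second dicycle through that arc. *)
Lemma off_dicycle C u u' v v' : C \in dicycles e ->
  (u, u') \in C -> (v, v') \in C -> connect (off C) u v -> u = v.
Proof.
move=> dC Cu Cv /connectP [p0 /shortenP [p ep up _] vE].
have [c [/andP [ec uc] CE _]] := dicycle_at dC Cu.
have : v \in u :: c.
  by move: Cv; rewrite CE => /cycle_arcs_mem /andP [].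
rewrite in_cons => /orP [/eqP // | cv]; exfalso.
have hp : has (mem c) p.
  apply/hasP; exists v => //.
  rewrite vE; case: (p) vE cv => [/= -> |a p' -> _]; last exact: (mem_last a p').
  by case/andP: uc => /negbTE ->.
case: (split_find hp) ep up {vE} => y1 p1 p2 cy1 hp1.
rewrite cat_path rcons_path => /andP [/andP [ep1 ey1] _].
rewrite -cat_cons cat_uniq -rcons_cons rcons_uniq => /andP [/andP [y1p1 up1] _].
case/splitPr: (cy1 : y1 \in c) ec uc CE hp1 => c1 c2 ec uc CE hp1.
(* Replace the stretch of [C] from [u] to [y1], the first return of [p] to [c], by [p1]. The result
   is a dicycle sharing with [C] the arc into [u], hence equal to [C], although its arc into [y1] is
   off [C]. *)
pose t := p1 ++ y1 :: c2.
have sub : subrel (off C) e by move=> a b /andP [].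
have et : dicycle e u t.
  rewrite /dicycle /t rcons_cat /= cat_path (sub_path sub ep1) /= (sub _ _ ey1) /=.
  move: ec; rewrite rcons_cat /= cat_path /= => /and3P [_ _ ->] /=.
  move: uc up1; rewrite /= mem_cat negb_or cat_uniq /= !in_cons !negb_or.
  move=> /and5P [/and3P [_ uy1 uc2] _ _ y1c2 uc2'] /andP [up1 up1'].
  rewrite mem_cat negb_or up1 in_cons negb_or uy1 uc2 /= cat_uniq up1' /=.
  move: y1p1; rewrite negb_or in_cons negb_or => /andP [_ ->]; rewrite y1c2 uc2' !andbT /=.
  apply: contra hp1 => /hasP [z z1 z2]; apply/hasP; exists z => //=.
  by rewrite mem_cat in_cons z1 !orbT.
have ut : uniq (u :: t) by case/andP: et.
have CE' : C = cycle_arcs (u :: t).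
  apply: (@dicycle_unique _ _ (last y1 c2) u) => //.
  - by apply/dicyclesP; exists u, t.
  - by rewrite CE (cycle_arcs_cons uc) rcons_cat pairmap_cat mem_cat /= -cats1 pairmap_cat
      in_cons mem_cat /= mem_head !orbT.
  - by rewrite (cycle_arcs_cons ut) /t rcons_cat pairmap_cat mem_cat /= -cats1 pairmap_cat
      in_cons mem_cat /= mem_head !orbT.
have : (last u p1, y1) \in C.
  by rewrite CE' (cycle_arcs_cons ut) /t rcons_cat pairmap_cat mem_cat /= mem_head !orbT.
by case/andP: ey1 => _ /negP.
Qed.

(** The second alternative occurs when [p] uses an arc of [C]; [g] is the tail of the first such
    arc. The companion [off_last] cuts after the last such arc instead. *)
Lemma off_first C u p : path e u p -> connect (off C) u (last u p) \/
  exists g g', [/\ g \in belast u p, (g, g') \in C & connect (off C) u g].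
Proof.
elim: p u => [|a p IHp] u /=; first by left; rewrite connect0.
case/andP => eua /IHp; case: (boolP ((u, a) \in C)) => Cua.
  by move=> _; right; exists u, a; rewrite mem_head connect0.
have cua : connect (off C) u a by apply: connect1; rewrite /off /= eua.
case=> [|[g [g' [gp Cg ag]]]]; first by left; apply: connect_trans cua _.
by right; exists g, g'; rewrite in_cons gp orbT Cg (connect_trans cua ag).
Qed.

Lemma off_last C u p : path e u p -> connect (off C) u (last u p) \/
  exists g g', [/\ g' \in p, (g, g') \in C & connect (off C) g' (last u p)].
Proof.
elim: p u => [|a p IHp] u /=; first by left; rewrite connect0.
case/andP => eua /IHp; case=> [apl|[g [g' [gp Cg ag]]]]; last first.
  by right; exists g, g'; rewrite in_cons gp orbT.
case: (boolP ((u, a) \in C)) => Cua; first by right; exists u, a; rewrite mem_head.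
by left; apply: connect_trans apl; apply: connect1; rewrite /off /= eua.
Qed.

Lemma dicycle_succ C g g' : C \in dicycles e -> (g, g') \in C -> exists g'', (g', g'') \in C.
Proof.
move=> dC Cg; have [c [/andP [_ uc] CE _]] := dicycle_at dC Cg.
move: Cg; rewrite CE => /cycle_arcs_mem /andP [_ g'c].
by exists (next (g :: c) g'); apply: mem_arc.
Qed.

(** Let [C] be the dicycle through [(x, z')]. The common endpoint [y] is reached off [C] both from
    [x] and from another vertex [v] of [C], and it reaches some vertex [h] of [C] off [C]. By
    [off_dicycle] both [x] and [v] equal [h], which is absurd. *)
Lemma no_divergence x z z' p q : path e x (z :: p) -> path e x (z' :: q) ->
  uniq (x :: z :: p) -> uniq (x :: z' :: q) -> last z p = last z' q -> z = z'.
Proof.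
move=> /= /andP [exz ep] /andP [exz' eq] /andP [xp up] /andP [xq uq] lpq.
apply/eqP; apply/negP => /negP zz'.
have [C dC Cxz'] := arc_on_dicycle exz'.
set y := last z p in lpq.
have Cxz : (x, z) \notin C.
  apply/negP => Cxz; have [c [_ CE z'E]] := dicycle_at dC Cxz'.
  move: Cxz zz'; rewrite CE => /imsetP [w _ [<- ->]].
  by rewrite z'E; case: (c) => [|b c'] /=; rewrite eqxx ?eqxx.
(* Should [p] use an arc of [C], the tail of the first one would be [x] again by [off_dicycle]. *)
have xy : connect (off C) x y.
  have xz : connect (off C) x z by apply: connect1; rewrite /off /= exz.
  case: (off_first C ep) => [|[g [g' [gp Cg zg]]]]; first exact: connect_trans.
  have xg : x = g := off_dicycle dC Cxz' Cg (connect_trans xz zg).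
  by move: xp; rewrite lastI mem_rcons in_cons xg gp orbT.
(* [v] is the head of the last arc of [C] on the second dipath. *)
have [v [v' [Cv vy xv]]] : exists v v', [/\ (v, v') \in C, connect (off C) v y & x != v].
  case: (off_last C eq) => [z'y|[g [g' [gq Cg g'y]]]].
    have [v' Cv] := dicycle_succ dC Cxz'.
    exists z', v'; split=> //; first by rewrite lpq.
    by apply: contraNneq xq => ->; rewrite mem_head.
  have [v' Cv] := dicycle_succ dC Cg.
  exists g', v'; split=> //; first by rewrite lpq.
  by apply: contraNneq xq => ->; rewrite in_cons gq orbT.
have [h [h' [Ch yh]]] : exists h h', (h, h') \in C /\ connect (off C) y h.
  have /connectP [r er xE] := cactus_strong y x.
  case: (off_first C er) => [|[g [g' [_ Cg yg]]]]; last by exists g, g'.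
  by rewrite -xE => yx; exists x, z'.
have xh := off_dicycle dC Cxz' Ch (connect_trans xy yh).
have vh := off_dicycle dC Cv Ch (connect_trans vy yh).
by move: xv; rewrite xh vh eqxx.
Qed.

Theorem cactus_unique_dipaths : unique_dipaths.
Proof.
move=> x y p; elim: p x => [|z p IHp] x [|z' q] //.
- by move=> [_ /= <- _] [_ /= lq /andP []]; rewrite -lq mem_last.
- by move=> [_ /= lq /andP [+ _]] [_ /= xy _]; rewrite xy -lq mem_last.
move=> [ep lp up] [eq lq uq].
have zz' : z = z' by apply: (no_divergence ep eq up uq); rewrite /= in lp lq; rewrite lp lq.
move: eq lq uq; rewrite -zz' => eq lq uq; congr (_ :: _).
by apply: (IHp z); [case/andP: ep lp up => _ ? ? /andP [_ ?]; split |
  case/andP: eq lq uq => _ ? ? /andP [_ ?]; split].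
Qed.

End UniqueDipaths.

(** * Leaf blocks *)

Section Leaves.

Variables (T : finType) (e : rel T).
Implicit Types (x y z u v w : T) (p c s : seq T).

Lemma mem_split (s : seq T) u : u \in s -> exists s1 s2, s = s1 ++ u :: s2.
Proof. by case/splitPr => s1 s2; exists s1, s2. Qed.

Lemma dipath_cat x y p1 p2 : dipath e x y (p1 ++ p2) ->
  dipath e x (last x p1) p1 /\ dipath e (last x p1) y p2.
Proof.
move=> [+ + up]; rewrite cat_path last_cat => /andP [ep1 ep2] lp2; split; split=> //.
  by move: up; rewrite -cat_cons cat_uniq => /and3P [].
move: up; rewrite -cat_cons lastI cat_rcons cat_uniq => /and3P [_ _].
by [].
Qed.

Lemma dipath_rcons x y z p : dipath e x y p -> e y z -> z \notin x :: p ->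
  dipath e x z (rcons p z).
Proof.
move=> [ep lp up] eyz zp.
by split; rewrite ?rcons_path ?ep ?lp ?last_rcons // -rcons_cons rcons_uniq zp.
Qed.

Lemma dipath_cons x y z p : dipath e y z p -> e x y -> x \notin y :: p ->
  dipath e x z (y :: p).
Proof. by move=> [ep lp up] exy xp; split=> //=; rewrite ?exy ?xp. Qed.

Hypothesis cactus_e : cactus e.

Let uniq_dp : unique_dipaths e := cactus_unique_dipaths cactus_e.

(** A block attached to the rest only at its gate [w]: every arc out of a vertex of [c] is the next
    arc of the cycle. That no arc enters [c] from outside the block is derived in [leaf_in]. *)
Definition leaf w c :=
  [/\ c <> [::], dicycle e w c &
      forall c1 u c2 y, c = c1 ++ u :: c2 -> e u y -> y = head w c2].

Section LeafTheory.

Variables (w : T) (c : seq T).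
Hypothesis leaf_c : leaf w c.

Let wc : w \notin c. Proof. by case: leaf_c => _ /andP [_ /= /andP []]. Qed.

Lemma leaf_out u y : u \in c -> e u y -> y \in w :: c.
Proof.
case: leaf_c => _ _ out uc euy; have [c1 [c2 cE]] := mem_split uc.
rewrite (out _ _ _ _ cE euy) cE.
by case: (c2) => [|a c3] /=; rewrite !(mem_cat, in_cons) eqxx ?orbT.
Qed.

Lemma leaf_exit x p : path e x p -> x \in c -> last x p \notin c -> w \in p.
Proof.
elim: p x => [|z p IHp] x /=; first by move=> _ ->.
case/andP => exz ep xc lp; have := leaf_out xc exz.
by rewrite !in_cons => /orP [/eqP ->|zc]; rewrite ?eqxx // (IHp z) ?orbT.
Qed.

Lemma leaf_cycle c1 u c2 : c = c1 ++ u :: c2 ->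
  dipath e w u (rcons c1 u) /\ dipath e u w (rcons c2 w).
Proof.
move=> cE; case: leaf_c => _ /andP [ec uc] _.
have d : dipath e w u (rcons c1 u).
  have [|//] := @dipath_cat w (last w c) (rcons c1 u) c2.
    rewrite cat_rcons -cE; split=> //.
    by move: ec; rewrite rcons_path => /andP [].
  by rewrite last_rcons.
split=> //.
move: ec; rewrite cE rcons_cat /= cat_path /= => /and3P [_ _ ec2].
split; rewrite ?last_rcons // -rcons_cons rcons_uniq.
move: uc; rewrite cE /= mem_cat cat_uniq !in_cons !negb_or /=.
by move=> /andP [/and3P [_ -> ->] /and4P [_ _ -> ->]].
Qed.

(** If [u] were outside, a dipath from [z] to [u] would leave the block through [w]. Its part after
    [w], prolonged by the arc to [z], would be a dipath from [w] to [z] besides the one around the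
    cycle. *)
Lemma leaf_in u z : e u z -> z \in c -> u \in w :: c.
Proof.
move=> euz zc; apply/negP => /negP uc.
have [p dp] := strong_dipath z u (cactus_strong cactus_e).
have wp : w \in p.
  case: dp => ep lp _; apply: (leaf_exit ep zc).
  by rewrite lp; apply: contra uc; rewrite in_cons => ->; rewrite orbT.
have zw : z != w by apply: contraNneq wc => <-.
case/splitPr: wp dp => p1 p2 dp.
have [_] := dipath_cat dp; move=> /(@dipath_cat _ _ [:: w]) [_ /= dp2].
have zp2 : z \notin w :: p2.
  by case: dp => _ _ /= /andP []; rewrite mem_cat negb_or => /andP [].
have [c1 [c2 cE]] := mem_split zc.
have [dc1 _] := leaf_cycle cE.
have /rcons_inj [p2E] := uniq_dp (dipath_rcons dp2 euz zp2) dc1.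
move: uc; rewrite cE -cat_cons mem_cat -p2E.
by case: dp2 => _ <- _; rewrite mem_last.
Qed.

Lemma leaf_enter x p : path e x p -> x \notin c -> last x p \in c -> w \in belast x p.
Proof.
elim: p x => [|z p IHp] x /=; first by move=> _ /negbTE ->.
case/andP => exz ep xc lp; rewrite in_cons.
have [zc|zc] := boolP (z \in c); last by rewrite (IHp z) ?orbT.
by have := leaf_in exz zc; rewrite in_cons (negbTE xc) orbF eq_sym => ->.
Qed.

(** Both entering and leaving [c] pass through [w], which a dipath visits only once. *)
Lemma leaf_avoid x y p z : dipath e x y p -> x \notin c -> y \notin c -> z \in p -> z \notin c.
Proof.
move=> dp xc yc zp; apply/negP => zc.
case/splitPr: zp dp => p1 p2; rewrite -cat_rcons => dp.
have [[ep1 _ _] [ep2 lp2 _]] := dipath_cat dp.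
have := leaf_enter ep1 xc; rewrite last_rcons => /(_ zc) w1.
have := leaf_exit ep2; rewrite lp2 last_rcons => /(_ zc yc) w2.
case: dp => _ _; rewrite -cat_cons cat_uniq lastI => /and3P [_ /hasP []].
by exists w => //=; rewrite mem_rcons in_cons w1 orbT.
Qed.

Lemma leaf_last_out y : e (last w c) y -> y = w.
Proof.
case: leaf_c => + _ out; case/lastP: c out => // c' p out _; rewrite last_rcons => ey.
by rewrite (out c' p [::] y) // cats1.
Qed.

Lemma leaf_head_in u : e u (head w c) -> u = w.
Proof.
move=> eu; have hc : head w c \in c by case: leaf_c; case: (c) => //= a l _ _ _; rewrite mem_head.
have := leaf_in eu hc; rewrite in_cons => /orP [/eqP //|uc].
case: leaf_c => _ /andP [_ /= /andP [_ +]] out.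
have [c1 [c2 cE]] := mem_split uc.
have := out _ _ _ _ cE eu; case: c2 cE => [|a c2] cE /= hE.
  by move: hc wc; rewrite hE => ->.
by rewrite cE in hE *; case: c1 hE {cE} => [|b c1] /= ->; rewrite ?mem_head // mem_cat !in_cons eqxx !orbT.
Qed.

Lemma leaf_head_out y : e (head w c) y -> y \in c.
Proof.
move=> ey; have hc : head w c \in c by case: leaf_c; case: (c) => //= a l _ _ _; rewrite mem_head.
have := leaf_out hc ey; rewrite in_cons => /orP [/eqP yw|//].
have ew : e w (head w c) by case: leaf_c => + /andP [+ _] _; case: (c) => //= a l _ /andP [].
rewrite yw in ey.
by move: wc; rewrite (cactus_asym cactus_e ew ey) hc.
Qed.

End LeafTheory.

Definition reach w z := connect [rel a b | e a b && (b != w)] z.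

Lemma reach_path w x p : path [rel a b | e a b && (b != w)] x p = path e x p && (w \notin p).
Proof.
elim: p x => //= y p IHp x; rewrite IHp in_cons negb_or eq_sym.
by case: (e x y); case: (w != y); case: (path e y p).
Qed.

Lemma reach_neq w z u : z != w -> reach w z u -> u != w.
Proof.
move=> zw /connectP [p]; rewrite reach_path => /andP [_ wp] ->.
by case: p wp => [|a p] //= wp; apply: contraNneq wp => <-; exact: mem_last.
Qed.

(* If a vertex u of the dicycle through (w, z) has another out-neighbour y, then
   reach u y is a proper part of reach w z. *)
Lemma leaf_exists w z : e w z ->
  exists w' c, leaf w' c /\ forall u, u \in c -> reach w z u.
Proof.
have [m] := ubnP #|[set u | reach w z u]|; elim: m w z => // m IHm w z ltm ewz.
have zw : z != w by apply: contraTneq ewz => ->; rewrite cactus_irr.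
have [p] := strong_dipath z w (cactus_strong cactus_e).
case/lastP: p => [[_ /= /eqP]|p w' []]; first by rewrite (negbTE zw).
rewrite last_rcons => ep w'E; rewrite {}w'E in ep *.
rewrite -rcons_cons rcons_uniq => /andP [wp up].
have rp u : u \in z :: p -> reach w z u.
  apply: path_connect; rewrite reach_path.
  move: ep wp; rewrite rcons_path in_cons negb_or => /andP [-> _] /andP [_ ->] //.
(* Either every vertex of the dicycle other than [w] has only its cycle arc, and the dicycle is a
   leaf, or some [u] branches off towards [y]. *)
case: (EM (exists c1 u c2 y, [/\ z :: p = c1 ++ u :: c2, e u y & y != head w c2])); last first.
  move=> H; exists w, (z :: p); split=> //; split=> //.
    by rewrite /dicycle rcons_cons /= ewz ep wp.
  move=> c1 u c2 y cE euy; apply/eqP; apply/negP => /negP yw; apply: H.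
  by exists c1, u, c2, y.
move=> [c1 [u [c2 [y [cE euy yh]]]]].
have yu : y != u by apply: contraTneq euy => ->; rewrite cactus_irr.
have ru : reach w z u by apply: rp; rewrite cE mem_cat mem_head orbT.
have dc2 : dipath e u w (rcons c2 w).
  have : path e w (rcons (z :: p) w) by rewrite /= ewz.
  rewrite cE rcons_cat rcons_cons cat_path /= => /and3P [_ _ ec2].
  split; rewrite ?last_rcons // -rcons_cons rcons_uniq.
  move: wp up; rewrite cE mem_cat cat_uniq negb_or => /andP [_ ->].
  by case/and3P.
(* A walk from [y] to [w] avoiding [u] would yield a second dipath from [u] to [w], besides the rest
   of the cycle. *)
have nw : ~~ reach u y w.
  apply/negP => /connectP [r0 /shortenP [r]]; rewrite reach_path => /andP [er ur] uyr _ wE.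
  have := uniq_dp (dipath_cons (And3 er (esym wE) uyr) euy _) dc2.
  rewrite in_cons negb_or eq_sym yu => /(_ ur).
  by case: (c2) yh => [|a c3] /= + [yE]; rewrite yE eqxx.
have sub v : reach u y v -> reach w z v.
  move=> /connectP [r er ->] {v}.
  have rr : {subset y :: r <= reach u y} by apply: path_connect.
  have zy : reach w z y.
    apply: connect_trans ru _; apply: connect1 => /=; rewrite euy /=.
    by apply: contraNneq nw => <-; apply: connect0.
  apply: connect_trans zy _; apply/connectP; exists r => //; rewrite reach_path.
  move: er; rewrite reach_path => /andP [-> _] /=.
  apply: contra nw => wr; apply: rr; by rewrite in_cons wr orbT.
have [|w1 [c [lc cr]]] := IHm u y _ euy; last first.
  by exists w1, c; split=> // v /cr; apply: sub.
rewrite -ltnS; apply: leq_trans ltm; rewrite ltnS; apply: proper_card; apply/properP; split.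
  by apply/subsetP => v; rewrite !inE; apply: sub.
exists u; rewrite ?inE //; apply/negP => /(reach_neq yu).
by rewrite eqxx.
Qed.

End Leaves.

(** * Merging colours *)

Section Colourings.

Variables (T : finType) (e : rel T).
Implicit Types (x y z u v w : T) (p q : seq T).

Lemma rvc_colourable_nat (cv : T -> nat) k : (forall x, cv x < k) ->
  (forall x y, exists2 p, dipath e x y p & uniq (map cv (internal x p))) ->
  rvc_colourable e k.
Proof.
move=> cvk cvP; exists (fun x => Ordinal (cvk x)) => x y.
have [p dp up] := cvP x y; exists p => //.
by rewrite -(map_inj_uniq val_inj) -map_comp.
Qed.

(** Arcs are coloured by their tails, which along [p] are [belast x p]; the [k2] tail colours are
    shifted past the [k1] vertex colours. *)
Lemma trc_colourable_nat (cv ct : T -> nat) k1 k2 :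
  (forall x, cv x < k1) -> (forall x, ct x < k2) ->
  (forall x y, exists2 p, dipath e x y p &
     uniq (map ct (belast x p)) && uniq (map cv (internal x p))) ->
  trc_colourable e (k1 + k2).
Proof.
move=> cvk ctk cP.
have cvk' x : cv x < k1 + k2 by rewrite ltn_addr.
have ctk' x : k1 + ct x < k1 + k2 by rewrite ltn_add2l.
exists (fun x => Ordinal (cvk' x)), (fun x _ => Ordinal (ctk' x)) => x y.
have [p dp /andP [ut uv]] := cP x y; exists p => //.
have tE : pairmap (fun x _ => Ordinal (ctk' x)) x p = map (fun x => Ordinal (ctk' x)) (belast x p).
  by elim: p x {dp ut uv} => //= z p IHp x; rewrite IHp.
rewrite -(map_inj_uniq val_inj) map_cat tE -!map_comp cat_uniq uv andbT.
rewrite (map_comp (addn k1) ct) (map_inj_uniq (@addnI k1)) ut /=.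
apply/hasPn => _ /mapP [z _ ->]; apply/negP => /mapP [b _ /= zE].
by have := cvk z; rewrite zE ltnNge leq_addr.
Qed.

Lemma uniq_map_index (f : T -> T) (A : {set T}) p : (forall x, f x \in A) ->
  uniq [seq index (f x) (enum A) | x <- p] = uniq (map f p).
Proof.
move=> fA; rewrite (map_comp (fun z => index z (enum A)) f) map_inj_in_uniq //.
by move=> a b /mapP [a' _ ->] /mapP [b' _ ->]; apply: (index_inj a'); rewrite mem_enum.
Qed.

(** Merging is expressed by maps [f] and [g] that send each vertex to a representative of its class
    of vertex colours or tail colours. *)
Lemma trc_colourable_sub (f g : T -> T) (A B : {set T}) :
  (forall x, f x \in A) -> (forall x, g x \in B) ->
  (forall x y, exists2 p, dipath e x y p &
     uniq (map g (belast x p)) && uniq (map f (internal x p))) ->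
  trc_colourable e (#|A| + #|B|).
Proof.
move=> fA gB fgP.
apply: (@trc_colourable_nat (fun x => index (f x) (enum A)) (fun x => index (g x) (enum B))).
- by move=> x; rewrite cardE index_mem mem_enum.
- by move=> x; rewrite cardE index_mem mem_enum.
move=> x y; have [p dp /andP [ug uf]] := fgP x y; exists p => //.
by rewrite !uniq_map_index // ug.
Qed.

Definition dead_end u v := forall p z, dipath e u v p -> e v z -> z \in u :: p.
Definition dead_start u v := forall p z, dipath e u v p -> e z u -> z \in u :: p.

(** Were [v] a later tail, the arc of [q] leaving [v] would prolong the dipath from [u] to [v] to a
    fresh vertex. *)
Lemma dead_end_belast u v y q :
  dead_end u v -> dipath e u y q -> v \in belast u q -> v = u.
Proof.
move=> uv dq vq; apply/eqP; apply/negP => /negP vu.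
have : v \in q by have := mem_belast vq; rewrite in_cons (negbTE vu).
case/mem_split => q1 [q2 qE]; move: dq vq; rewrite qE -cat_rcons => dq.
case: q2 {qE} dq => [|z q2] dq.
  rewrite cats0 belast_rcons in_cons (negbTE vu) /= => vq1.
  by case: dq => _ _; rewrite cats0 /= rcons_uniq vq1 andbF.
move=> _; have [dq1 [+ _ _]] := dipath_cat dq; rewrite last_rcons /= => /andP [evz _].
rewrite last_rcons in dq1; have zq1 := uv _ _ dq1 evz.
by case: dq => _ _; rewrite -cat_cons cat_uniq => /and3P [_ /hasP []]; exists z; rewrite ?mem_head.
Qed.

Lemma mem_splitl x p u : u \in x :: p -> exists p1 p2, p = p1 ++ p2 /\ last x p1 = u.
Proof. by case/splitPl => p1 p2 uE; exists p1, p2. Qed.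

(** Whichever of [u], [v] comes first on [p] has a dipath to the other which [p] prolongs, so mutual
    dead ends can share a tail colour. *)
Lemma dead_ends_belast x y p u v : dead_end u v -> dead_end v u ->
  dipath e x y p -> u \in belast x p -> v \in belast x p -> u = v.
Proof.
move=> uv vu dp up vp; have [p1 [p2 [pE uE]]] := mem_splitl (mem_belast up).
move: dp up vp; rewrite pE => dp; have [dp1 dp2] := dipath_cat dp.
rewrite belast_cat !mem_cat uE => up /orP [vp1|vp2]; last first.
  by rewrite uE in dp2; rewrite (dead_end_belast uv dp2).
have up2 : u \in belast u p2.
  case: (p2) up => [|z p3 _]; last by rewrite mem_head.
  by case: dp1 => _ _; rewrite lastI uE rcons_uniq => /andP [/negbTE ->].
have [q1 [q2 [p1E vE]]] := mem_splitl (mem_belast vp1).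
move: dp; rewrite p1E -catA => /dipath_cat [_]; rewrite vE => dq2.
apply: (dead_end_belast vu dq2).
by rewrite belast_cat mem_cat -{2}vE -last_cat -p1E uE up2 orbT.
Qed.

Lemma dead_start_path u v x q :
  dead_start u v -> dipath e x v (u :: q) -> v = u.
Proof.
move=> uv [/= /andP [exu eq] lq /and3P [xuq uq ueq]].
have : x \in u :: q by apply: uv exu; split=> //=; rewrite uq.
by rewrite (negbTE xuq).
Qed.

(** Neither vertex starts the dipath, so the earlier one has a predecessor on it, which would
    prolong the dipath between them backwards. *)
Lemma dead_starts_behead x y p u v : dead_start u v -> dead_start v u ->
  dipath e x y p -> u \in p -> v \in p -> u = v.
Proof.
move=> uv vu dp up vp; apply/eqP; apply/negP => /negP nuv.
have [p1 [p2 pE]] := mem_split up.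
move: dp vp; rewrite pE mem_cat in_cons => dp.
rewrite eq_sym (negbTE nuv) /= => /orP [vp1|vp2].
  have [q1 [q2 p1E]] := mem_split vp1.
  move: dp; rewrite p1E -catA => /dipath_cat [_].
  rewrite cat_cons -cat_rcons -cat_cons => /dipath_cat [+ _].
  by rewrite /= last_rcons => /(dead_start_path vu) uE; rewrite uE eqxx in nuv.
have [q1 [q2 p2E]] := mem_split vp2.
move: dp; rewrite p2E => /dipath_cat [_].
rewrite -cat_rcons -cat_cons => /dipath_cat [+ _].
by rewrite /= last_rcons => /(dead_start_path uv) vE; rewrite vE eqxx in nuv.
Qed.

End Colourings.

(** * Excluding the value [2n - 4] *)

Section NotTwoNMinusFour.

Variables (T : finType) (e : rel T).
Hypothesis cactus_e : cactus e.
Implicit Types (x y z u v w : T) (p q c : seq T).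

Let uniq_dp : unique_dipaths e := cactus_unique_dipaths cactus_e.

Lemma dipath_extend w z p : dipath e w z p ->
  exists x q, dipath e w x (p ++ q) /\ forall v, e x v -> v \in w :: p ++ q.
Proof.
have [m] := ubnP (#|T| - size p); elim: m z p => // m IHm z p ltm dp.
have [H|H] := EM (exists2 v, e z v & v \notin w :: p); last first.
  exists z, [::]; rewrite cats0; split=> // v ezv; apply/negP => /negP vp.
  by apply: H; exists v.
have [v ezv vp] := H; have dv := dipath_rcons dp ezv vp.
have szp : size (rcons p v) < #|T|.
  case: dv => _ _ /card_uniqP uE; apply: leq_trans (max_card (mem (w :: rcons p v))).
  by rewrite uE.
have [|x [q [dq maxq]]] := IHm _ _ _ dv; first by rewrite size_rcons in szp *; lia.
by exists x, (v :: q); rewrite -cat_rcons.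
Qed.

(** The dipath is forced, so its [size p] arcs and [(size p).-1] internal vertices need distinct
    colours. *)
Lemma rainbow_dipath x y p k : trc_colourable e k -> dipath e x y p ->
  size p + (size p).-1 <= k.
Proof.
move=> [cv [ca rc]] dp; have [q dq] := rc x y.
rewrite (uniq_dp dq dp) => /card_uniqP uE.
have <- : size (pairmap ca x p ++ map cv (internal x p)) = size p + (size p).-1.
  by rewrite size_cat size_pairmap size_map /internal size_behead size_belast.
by rewrite -uE -[k in _ <= k]card_ord max_card.
Qed.

(** Otherwise no arc leaves the block, which by strong connectivity contains every vertex and hence
    every arc; any dicycle then shares an arc with the block and equals it. *)
Lemma leaf_branch w c : 2 <= #|dicycles e| -> leaf e w c ->
  exists2 y, e w y & y != head w c.
Proof.
move=> q2 lc; apply: contrapT => H.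
have outw y : e w y -> y = head w c.
  by move=> ewy; apply/eqP; apply/negP => /negP yw; apply: H; exists y.
have [c0 /andP [ec uc] out] := lc.
have cl x y : x \in w :: c -> e x y -> (x, y) \in cycle_arcs (w :: c).
  rewrite (cycle_arcs_cons uc) in_cons => /orP [/eqP -> /outw ->|].
    by case: (c) => [|a c'] /=; rewrite mem_head.
  case/mem_split => c1 [c2 cE] /(out _ _ _ _ cE) ->.
  rewrite cE rcons_cat pairmap_cat mem_cat /=.
  by case: (c2) => [|a c'] /=; rewrite !in_cons eqxx !orbT.
have all x : x \in w :: c.
  have /connectP [p ep ->] := cactus_strong cactus_e w x.
  suff H' v : v \in w :: c -> path e v p -> last v p \in w :: c by rewrite H' ?mem_head.
  elim: p v {ep} => [|z p IHp] v //= vc /andP [evz]; apply: IHp.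
  by have /cycle_arcs_mem /andP [] := cl _ _ vc evz.
suff : #|dicycles e| <= 1 by rewrite leqNgt q2.
rewrite -(cards1 (cycle_arcs (w :: c))); apply: subset_leq_card.
apply/subsetP => C dC; rewrite inE; apply/eqP.
have dw : cycle_arcs (w :: c) \in dicycles e by apply/dicyclesP; exists w, c; rewrite /dicycle ec.
have /dicyclesP [x [d [/andP [ed ud] CE]]] := dC.
have Cx : (x, head x d) \in C.
  by rewrite CE (cycle_arcs_cons ud); case: (d) => [|a d'] /=; rewrite mem_head.
apply: (dicycle_unique cactus_e dC dw Cx); apply: cl => //.
by case: (d) ed => [|a d'] /= /andP [].
Qed.

Lemma leaf_head_neq_last w c : leaf e w c -> head w c != last w c.
Proof.
move=> lc; have [c0 /andP [_ /= /andP [wc _]] _] := lc.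
have [z [q [[/= /andP [ez _] _ _]]]] : exists z q, dipath e (head w c) w (z :: q).
  have [c' cE] : exists c', c = head w c :: c' by case: (c) c0 => // a c' _; exists c'.
  have [_ d] := leaf_cycle lc (cE : c = [::] ++ _).
  by case: (c') d => [|a c2] d; [exists w, [::] | exists a, (rcons c2 w)].
apply: contraNneq wc => sp; have zc := leaf_head_out cactus_e lc ez.
by rewrite sp in ez; rewrite -(leaf_last_out lc ez).
Qed.

Lemma leaf_head_mem w c : leaf e w c -> head w c \in c.
Proof. by case; case: c => //= a c _ _ _; rewrite mem_head. Qed.

Lemma leaf_last_mem w c : leaf e w c -> last w c \in c.
Proof. by case; case: c => //= a c _ _ _; rewrite mem_last. Qed.

(** The only arc out of the last vertex leads to [w], through which the dipath entered the block. *)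
Lemma leaf_dead_end_last w c x : leaf e w c -> x \notin c -> dead_end e x (last w c).
Proof.
move=> lc xc p z [ep lp up] /(leaf_last_out lc) ->.
apply: mem_belast; apply: (leaf_enter cactus_e lc) => //.
by rewrite lp leaf_last_mem.
Qed.

Lemma leaf_dead_start_head w c x : leaf e w c -> x \notin c -> dead_start e (head w c) x.
Proof.
move=> lc xc p z [ep lp up] /(leaf_head_in cactus_e lc) ->.
by rewrite in_cons (leaf_exit lc ep) ?orbT ?lp // leaf_head_mem.
Qed.

(** The dipath from the last vertex of [c] starts with the arc to [w], so it can be prolonged only
    if the one from [w] can. *)
Lemma leaf_dead_end w c x : leaf e w c -> x \notin c ->
  dead_end e w x -> dead_end e (last w c) x.
Proof.
move=> lc xc wx p z dp exz; case: p dp => [[_ /= lx _]|a p dp].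
  by rewrite -lx leaf_last_mem in xc.
have aw : a = w by case: dp => /= /andP [/(leaf_last_out lc)].
rewrite {}aw in dp *; rewrite in_cons; apply/orP; right; apply: wx exz.
by have [_] := @dipath_cat _ _ _ _ [:: w] _ dp.
Qed.

(* The path from the head of the first leaf to the last vertex of the second
   one is not Hamiltonian; extending a path from w1 to a vertex off it yields x. *)
Lemma other_dead_end w1 c1 w2 c2 :
  (forall x y p, dipath e x y p -> (size p).+1 < #|T|) ->
  leaf e w1 c1 -> leaf e w2 c2 -> ~~ has (mem c1) c2 -> w1 \notin c2 -> w2 \notin c1 ->
  exists x, [/\ x \notin c1, x != last w2 c2, x != head w2 c2 & dead_end e w1 x].
Proof.
move=> noham l1 l2 c12 w1c2 w2c1.
have c2c1 x : x \in c2 -> x \notin c1 by move=> xc; apply: (hasPn c12).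
have w1c1 : w1 \notin c1 by case: l1 => _ /andP [_ /= /andP []].
have p2c1 : last w2 c2 \notin c1 by apply: c2c1; apply: leaf_last_mem.
have [Q dQ] := strong_dipath w1 (last w2 c2) (cactus_strong cactus_e).
have [c' cE] : exists c', c1 = head w1 c1 :: c' by case: l1; case: (c1) => // a c' _; exists c'.
have [_ [ec1 _ uc1]] := leaf_cycle l1 (cE : c1 = [::] ++ _).
have Qc1 z : z \in Q -> z \notin c1 := leaf_avoid cactus_e l1 dQ w1c1 p2c1.
(* The dipath around [c1] to [w1], followed by [Q], is not Hamiltonian, so it misses some [z0]. *)
have [z0 z0c] : exists z0, z0 \notin c1 ++ w1 :: Q.
  apply: contrapT => H.
  have allz z : z \in c1 ++ w1 :: Q by apply: contrapT => /negP zc; apply: H; exists z.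
  have := noham (head w1 c1) (last w2 c2) (rcons c' w1 ++ Q).
  have -> : #|T| = #|c1 ++ w1 :: Q| by apply: eq_card => z; rewrite allz.
  have szE : (size (rcons c' w1 ++ Q)).+1 = size (c1 ++ w1 :: Q).
    by rewrite cE !size_cat /= size_rcons /=; lia.
  rewrite szE => H'; have : size (c1 ++ w1 :: Q) < #|c1 ++ w1 :: Q|.
    apply: H'; case: dQ => eQ lQ uQ; split.
    - by rewrite cat_path ec1 last_rcons.
    - by rewrite last_cat last_rcons.
    - rewrite cat_rcons -cat_cons -cE cat_uniq uQ andbT; apply/andP; split.
        by case: l1 => _ /andP [_ /= /andP []].
      by apply/hasPn => z; rewrite in_cons => /orP [/eqP ->|/Qc1].
  by rewrite ltnNge card_size.
move: z0c; rewrite mem_cat in_cons !negb_or => /and3P [z0c1 z0w1 z0Q].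
have [p dp] := strong_dipath w1 z0 (cactus_strong cactus_e).
have z0p : z0 \in p.
  case: (p) dp => [[_ /= zE _]|a p' [_ <- _]]; last exact: (mem_last a p').
  by rewrite zE eqxx in z0w1.
have [x [q [dq maxx]]] := dipath_extend dp.
have [_] := dipath_cat dq; have -> : last w1 p = z0 by case: dp.
move=> dz0; exists x; split.
(* Ending inside [c1] would require passing [w1] again. *)
- apply/negP => xc1; case: dz0 => eq lq _.
  have := leaf_enter cactus_e l1 eq z0c1; rewrite lq => /(_ xc1) /mem_belast.
  rewrite in_cons eq_sym (negbTE z0w1) /= => w1q.
  by case: dq => _ _ /= /andP []; rewrite mem_cat w1q orbT.
(* The dipath from [w1] to the last vertex of [c2] is [Q], which avoids [z0]. *)
- apply: contraNneq z0Q => xE; rewrite xE in dq.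
  by rewrite (uniq_dp dQ dq) mem_cat z0p.
(* The head of [c2] is entered from [w2], so its successor on [c2] is still unvisited and the dipath
   would not be maximal. *)
- apply/negP => /eqP xs.
  have [r [v rE]] : exists r v, p ++ q = rcons r v.
    have : z0 \in p ++ q by rewrite mem_cat z0p.
    by case: (lastP (p ++ q)) => // r v _; exists r, v.
  rewrite rE in dq maxx; have vx : v = x by case: dq => _; rewrite last_rcons.
  rewrite {}vx in dq maxx; have [er _ ur] := dq.
  have lr : last w1 r = w2.
    by move: er; rewrite rcons_path xs => /andP [_ /(leaf_head_in cactus_e l2)].
  have w2c2 : w2 \notin c2 by case: l2 => _ /andP [_ /= /andP []].
  have dr : dipath e w1 w2 r.
    by rewrite -cats1 in dq; have [] := dipath_cat dq; rewrite lr.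
  have [[|z t] [/= et lt ut]] := strong_dipath x w2 (cactus_strong cactus_e).
    by rewrite -lt xs leaf_head_mem in w2c2.
  have exz : e x z by case/andP: et.
  have zc2 : z \in c2 by apply: (leaf_head_out cactus_e l2); rewrite -xs.
  have := maxx _ exz; rewrite in_cons mem_rcons in_cons => /or3P [/eqP zE|/eqP zE|zr].
  + by rewrite -zE zc2 in w1c2.
  + by rewrite zE (cactus_irr cactus_e) in exz.
  + by have := leaf_avoid cactus_e l2 dr w1c2 w2c2 zr; rewrite zc2.
- by move=> p' v dp' /maxx; rewrite (uniq_dp dp' dq).
Qed.

Lemma leaf_arc w c : leaf e w c -> e w (head w c).
Proof. by case; case: c => //= a c _ /andP [/andP [+ _] _]. Qed.

Lemma leaf_only_arc w c y : leaf e w c -> e w y -> y != head w c -> y \notin c.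
Proof.
move=> lc ewy; apply: contra => /mem_split [a [b cE]].
have [d _] := leaf_cycle lc cE.
have wy : w != y by apply: contraTneq ewy => ->; rewrite cactus_irr.
have d' : dipath e w y [:: y] by split; rewrite //= ?ewy // inE wy.
have := uniq_dp d d'; rewrite cE; case: (a) => [|a0 [|a1 a']] //=.
Qed.

(** The second leaf is sought beyond an arc that leaves the gate [w1] of the first away from its
    block, among the vertices reached without returning to [w1]. *)
Lemma two_leaves : 2 <= #|dicycles e| -> exists w1 c1 w2 c2,
  [/\ leaf e w1 c1, leaf e w2 c2, ~~ has (mem c1) c2, w1 \notin c2 & w2 \notin c1].
Proof.
move=> q2.
have [x0 [x1 ex01]] : exists x0 x1, e x0 x1.
  have /card_gt0P [C /dicyclesP [x [c [/andP [+ _] _]]]] : 0 < #|dicycles e| by apply: leq_trans q2.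
  by case: c => [|a c] /= /andP []; exists x; eexists; eassumption.
have [w1 [c1 [l1 _]]] := leaf_exists cactus_e ex01.
have [y1 ey1 y1s] := leaf_branch q2 l1.
have [w2 [c2 [l2 r2]]] := leaf_exists cactus_e ey1.
have y1w : y1 != w1 by apply: contraTneq ey1 => ->; rewrite cactus_irr.
have w1c2 : w1 \notin c2 by apply/negP => /r2 /(reach_neq y1w); rewrite eqxx.
have c12 x : x \in c2 -> x \notin c1.
  move=> /r2 /connectP [p]; rewrite reach_path => /andP [ep w1p] ->.
  apply: contra w1p => xc1.
  have := leaf_enter cactus_e l1 ep (leaf_only_arc l1 ey1 y1s) xc1.
  by move/mem_belast; rewrite in_cons eq_sym (negbTE y1w).
exists w1, c1, w2, c2; split=> //; first by apply/hasPn.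
apply/negP => w2c1; have h2 := leaf_head_mem l2.
have := leaf_out l1 w2c1 (leaf_arc l2); rewrite in_cons (negbTE (c12 _ h2)) orbF.
by move=> /eqP w1E; rewrite -w1E h2 in w1c2.
Qed.

Lemma trc_nonhamiltonian : 2 <= #|dicycles e| ->
  (forall x y p, dipath e x y p -> (size p).+1 < #|T|) ->
  trc_colourable e (#|T| - 3 + (#|T| - 2)).
Proof.
move=> q2 noham.
have [w1 [c1 [w2 [c2 [l1 l2 c12 w1c2 w2c1]]]]] := two_leaves q2.
have c21 : ~~ has (mem c2) c1 by rewrite has_sym.
have [x [xc1 xp2 xs2 dx]] := other_dead_end noham l1 l2 c12 w1c2 w2c1.
have [y [yc2 yp1 ys1 dy]] := other_dead_end noham l2 l1 c21 w2c1 w1c2.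
set p1 := last w1 c1 in yp1; set p2 := last w2 c2 in xp2.
set s1 := head w1 c1 in ys1; set s2 := head w2 c2 in xs2.
have [p1c p2c] : p1 \in c1 /\ p2 \in c2 by split; apply: leaf_last_mem.
have [s1c s2c] : s1 \in c1 /\ s2 \in c2 by split; apply: leaf_head_mem.
have notc1 z : z \in c2 -> z \notin c1 by move=> zc; apply: (hasPn c12).
have notc2 z : z \in c1 -> z \notin c2 by move=> zc; apply: (hasPn c21).
have neq12 u v : u \in c1 -> v \in c2 -> u != v.
  by move=> uc /notc1; apply: contraNneq => <-.
have p1x : p1 != x by apply: contraNneq xc1 => <-.
have p2y : p2 != y by apply: contraNneq yc2 => <-.
have s1x : s1 != x by apply: contraNneq xc1 => <-.
have s2y : s2 != y by apply: contraNneq yc2 => <-.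
have s1p1 : s1 != p1 by apply: leaf_head_neq_last.
have s2p2 : s2 != p2 by apply: leaf_head_neq_last.
have s2x : s2 != x by rewrite eq_sym.
have s1y : s1 != y by rewrite eq_sym.
have p2x : p2 != x by rewrite eq_sym.
have p1y : p1 != y by rewrite eq_sym.
have s2p1 : s2 != p1 by rewrite eq_sym neq12.
pose M u v := dead_end e u v /\ dead_end e v u.
have Mp1 z : z \notin c1 -> dead_end e p1 z -> M p1 z.
  by move=> zc d; split=> //; apply: leaf_dead_end_last.
have Mp2 z : z \notin c2 -> dead_end e p2 z -> M p2 z.
  by move=> zc d; split=> //; apply: leaf_dead_end_last.
have M12 : M p1 p2 by apply: Mp1 (notc1 _ p2c) (leaf_dead_end_last l2 (notc2 _ p1c)).
have M1x : M p1 x by apply: Mp1 (xc1) (leaf_dead_end l1 xc1 dx).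
have M2y : M p2 y by apply: Mp2 (yc2) (leaf_dead_end l2 yc2 dy).
have Msym u v : M u v -> M v u by case.
(* [a] will take the colour of [a'], and [b] that of [b']. If [x = y], then [x], [p1], [p2] form a
   single class; either way two colours are saved, and [s1], [s2] are not involved. *)
have [a [a' [b [b' [ab nab [Ma Mb Mab] sab]]]]] : exists a a' b b',
  [/\ a != b, [&& a' != a, a' != b, b' != a & b' != b],
      [/\ M a a', M b b' & a' = b' -> M a b] &
      forall s, s \in [:: s1; s2] -> s \notin [:: a; a'; b; b']].
  have [xy|xy] := eqVneq x y.
    exists x, p1, p2, p1; split.
    - by [].
    - by rewrite p1x neq12.
    - by split; [apply: Msym | apply: Msym | move=> _; apply: Msym; rewrite xy].
    - move=> s; rewrite !inE !negb_or => /orP [] /eqP ->.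
        by rewrite s1x s1p1 neq12.
      by rewrite s2x s2p2 s2p1.
  exists x, p1, y, p2; split=> //.
  - by rewrite p1x p1y p2x p2y.
  - by split; [apply: Msym | apply: Msym | move=> p12; move: (neq12 _ _ p1c p2c); rewrite p12 eqxx].
  - move=> s; rewrite !inE !negb_or => /orP [] /eqP ->.
      by rewrite s1x s1p1 s1y neq12.
    by rewrite s2x s2y s2p2 s2p1.
pose g u := if u == a then a' else if u == b then b' else u.
have gab u : (g u != a) && (g u != b).
  case/and4P: nab => a'a a'b b'a b'b.
  by rewrite /g; case: (eqVneq u a) => [_|ua]; [rewrite a'a | case: (eqVneq u b) => [_|ub]; rewrite ?b'a ?ua].
have gM u v : g u = g v -> u != v -> M u v.
  rewrite /g; case: (eqVneq u a) => [->|ua]; case: (eqVneq v a) => [->|va]; rewrite ?eqxx //.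
  - by case: (eqVneq v b) => [-> /Mab|_ <-].
  - by case: (eqVneq u b) => [-> /esym /Mab /Msym|_ -> _]; last exact: Msym.
  - case: (eqVneq u b) => [->|ub]; case: (eqVneq v b) => [->|vb]; rewrite ?eqxx //.
    + by move=> <-.
    + by move=> -> _; apply: Msym.
    + by move=> ->; rewrite eqxx.
have ge s u : s \in [:: s1; s2] -> (g u == s) = (u == s).
  move/sab; rewrite !inE !negb_or => /and4P [sa sa' sb sb'].
  rewrite /g; case: (eqVneq u a) => [->|_].
    by rewrite ![_ == s]eq_sym (negbTE sa) (negbTE sa').
  by case: (eqVneq u b) => [->|_] //; rewrite ![_ == s]eq_sym (negbTE sb) (negbTE sb').
have gs : [&& s1 != a, s1 != b, s2 != a & s2 != b].
  have := sab s1; have := sab s2; rewrite !inE !eqxx ?orbT !negb_or.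
  by move=> /(_ isT) /and4P [-> _ -> _] /(_ isT) /and4P [-> _ -> _].
(* The tail colours are given by [g]; the vertex colours in addition identify [s2] with [s1]. *)
pose f u := if g u == s2 then s1 else g u.
have DS : dead_start e s1 s2 /\ dead_start e s2 s1.
  by split; apply: leaf_dead_start_head => //; [apply: notc1|apply: notc2].
have -> : #|T| - 3 = #|~: [set a; b; s2]|.
  rewrite [RHS]cardsCs setCK setUC cardsU1 !inE cards2 ab.
  by case/and4P: gs => _ _ /negbTE -> /negbTE ->.
have -> : #|T| - 2 = #|~: [set a; b]| by rewrite [RHS]cardsCs setCK cards2 ab.
apply: (@trc_colourable_sub _ _ f g).
- move=> u; rewrite /f !inE !negb_or.
  case: (eqVneq (g u) s2) => [_|->]; last by rewrite andbT.
  by case/and4P: gs => -> -> _ _ /=; apply: neq12.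
- by move=> u; rewrite !inE negb_or.
move=> u v; have [p dp] := strong_dipath u v (cactus_strong cactus_e).
exists p => //; case: (dp) => _ _ up; apply/andP; split.
  rewrite map_inj_in_uniq; last first.
    move=> z z' zp z'p; have [-> //|nz] := eqVneq z z'; move=> /gM /(_ nz) [zz' z'z].
    by rewrite (dead_ends_belast zz' z'z dp zp z'p).
  by move: up; rewrite lastI rcons_uniq => /andP [].
(* Internal vertices are both tails and heads of arcs of [p], so both merging criteria apply to
   them. *)
have subp z : z \in internal u p -> (z \in belast u p) && (z \in p).
  move=> zi; rewrite (mem_behead zi) /=.
  case: (p) zi => //= z0 q; rewrite /internal /=; exact: mem_belast.
rewrite map_inj_in_uniq ?uniq_internal // => z z' /subp /andP [zp zp'] /subp /andP [z'p z'p'].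
rewrite /f !ge ?inE ?eqxx ?orbT //.
(* Only [s1] itself has [g]-value [s1], so a clash caused by the last merging puts both [s1] and
   [s2] on [p]. *)
have ns : forall z1 z2, z1 \in p -> z2 \in p -> z1 = s2 -> s1 = g z2 -> z1 = z2.
  move=> z1 z2 z1p z2p z1E /esym /eqP; rewrite ge ?mem_head // => /eqP z2E.
  have s12 : s1 = s2.
    by apply: (dead_starts_behead (proj1 DS) (proj2 DS) dp); rewrite -?z1E -?z2E.
  by move: (neq12 _ _ s1c s2c); rewrite s12 eqxx.
have [zs|zs] := eqVneq z s2; have [z's|z's] := eqVneq z' s2.
- by rewrite zs z's.
- exact: ns.
- by move/esym => h; rewrite (ns z' z).
- have [-> //|nz] := eqVneq z z'; move=> /gM /(_ nz) [zz' z'z].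
  by rewrite (dead_ends_belast zz' z'z dp zp z'p).
Qed.

Theorem trc_neq : 2 <= #|dicycles e| -> trc e <> 2 * #|T| - 4.
Proof.
move=> q2 trcE.
have [w [c [_ [_ [lc _ _ _ _]]]]] := two_leaves q2.
(* With at least three vertices the truncated subtractions below are exact. *)
have gt2 : 2 < #|T|.
  have uc : uniq [:: w; head w c; last w c].
    have wc : w \notin c by case: lc => _ /andP [_ /= /andP []].
    rewrite /= !inE (leaf_head_neq_last lc) negb_or !andbT.
    by apply/andP; split; apply: contraNneq wc => {1}->; rewrite ?leaf_head_mem ?leaf_last_mem.
  by rewrite -[3]/(size [:: w; head w c; last w c]) -(card_uniqP uc) max_card.
have [trcP mintrc] := trc_minimal (cactus_strong cactus_e).
have [[x [y [p [dp hp]]]]|H] :=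
    EM (exists x y p, dipath e x y p /\ #|T| <= (size p).+1).
  have := rainbow_dipath trcP dp; lia.
suff /mintrc : trc_colourable e (#|T| - 3 + (#|T| - 2)) by lia.
apply: trc_nonhamiltonian => // x y p dp; rewrite ltnNge; apply/negP => hp.
by apply: H; exists x, y, p.
Qed.

End NotTwoNMinusFour.

(** * Attaching a cycle *)

Section Tails.

Variables (T : eqType) (e : rel T).
Implicit Types (x y z : T) (s t : seq T).

(* A dipath from x to y recorded by the list t of the tails of its arcs, so
   that concatenation of dipaths is concatenation of lists. *)
Definition tpath x y t := [&& sorted e (rcons t y), head y t == x & uniq (rcons t y)].

Lemma tpath_loop x t : tpath x x t -> t = [::].
Proof.
case/and3P => _; case: t => //= a t /eqP ->.
by rewrite mem_rcons mem_head.
Qed.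

Lemma tpath_head x y t : tpath x y t -> x != y -> t = x :: behead t.
Proof. by case/and3P => _; case: t => [|a t] /= /eqP -> //; rewrite eqxx. Qed.

Lemma tpath_cons x y z t : tpath y z t -> e x y -> x \notin rcons t z -> tpath x z (x :: t).
Proof.
case/and3P => st /eqP hy ut exy xt; rewrite /tpath /= eqxx xt ut /= andbT.
by case: t st hy {ut xt} => [|a t] /= st ay; rewrite ay exy ?st // -ay.
Qed.

Lemma tpath_rcons x y z t : tpath x y t -> e y z -> z \notin rcons t y -> tpath x z (rcons t y).
Proof.
case/and3P => st hx ut eyz zt; rewrite /tpath (rcons_uniq _ z) zt ut.
case: t st hx {ut zt} => [|a t] /= st hx; rewrite ?hx ?eyz //=.
by rewrite rcons_path st last_rcons eyz.
Qed.

Lemma tpath_cat x y z s t : tpath x y s -> tpath y z t -> ~~ has (mem s) (rcons t z) ->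
  tpath x z (s ++ t).
Proof.
case/and3P => ss hx us /and3P [st /eqP hy ut] st0.
rewrite /tpath rcons_cat cat_uniq st0 ut !andbT.
move: us; rewrite rcons_uniq => /andP [_ ->]; rewrite andbT.
case: s ss hx {st0} => [|a s] /=; first by move=> _ /eqP <-; rewrite st hy eqxx.
rewrite rcons_path => /andP [ss ey] ->; rewrite andbT cat_path ss /=.
by case: t st hy {ut} => [|b t] /= st hy; rewrite hy ey // -hy.
Qed.

End Tails.

Lemma tpath_dipath (T : finType) (e : rel T) x y t : tpath e x y t ->
  exists2 p, dipath e x y p & belast x p = t.
Proof.
case/and3P => st /eqP hx ut; exists (behead (rcons t y)).
  by case: t st hx ut => [|a t] /=; [move=> _ <- | move=> st <- ut; split; rewrite ?last_rcons].
by case: t hx {st ut} => [|a t] //= <-; rewrite belast_rcons.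
Qed.

Lemma dipath_tpath (T : finType) (e : rel T) x y p : dipath e x y p -> tpath e x y (belast x p).
Proof.
case=> ep lp up; rewrite /tpath -{1 3}lp -lastI up /= ep andbT /=.
by case: p lp {ep up} => [|a p] //= ->; rewrite eqxx.
Qed.

Lemma sorted_iota i k : sorted (fun a b => b == a.+1) (iota i k).
Proof. by case: k => //= k; elim: k i => //= k IHk i; rewrite eqxx IHk. Qed.

Section Attach.

Variables (T : finType) (e : rel T) (v : T) (m : nat).

(** The new cycle has length [m + 1]: it runs from the gate [v] through the new vertices
    [0, ..., m - 1] and back to [v]. *)
Definition attach : rel (T + 'I_m) := fun a b =>
  match a, b with
  | inl x, inl y => e x y
  | inl x, inr j => (x == v) && (j == 0 :> nat)
  | inr i, inl y => (y == v) && (i.+1 == m)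
  | inr i, inr j => j == i.+1 :> nat
  end.

Definition seg i j : seq 'I_m := pmap insub (iota i (j - i)).

Lemma val_seg i j : j <= m -> map val (seg i j) = iota i (j - i).
Proof.
move=> jm; rewrite /seg (pmap_filter (insubK _)).
apply/all_filterP/allP => k; rewrite mem_iota isSome_insub; lia.
Qed.

Lemma mem_seg i j (k : 'I_m) : j <= m -> (k \in seg i j) = (i <= k < j).
Proof.
move=> jm; rewrite -(mem_map val_inj) val_seg // mem_iota /=.
lia.
Qed.

Lemma seg_rcons i j (k : 'I_m) : i <= k -> k.+1 = j -> seg i j = rcons (seg i k) k.
Proof.
move=> ik kj; apply: (inj_map val_inj); rewrite map_rcons !val_seg ?(ltnW (ltn_ord k)) -?kj //.
by rewrite subSn // -addn1 iotaD cats1 subnKC.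
Qed.

Hypothesis m_gt1 : 1 < m.

Let first : 'I_m := Ordinal (ltnW m_gt1).

Let last_lt : m.-1 < m. Proof. lia. Qed.
Let final : 'I_m := Ordinal last_lt.

Notation injl := (map (@inl T 'I_m)).
Notation injr := (map (@inr T 'I_m)).

Lemma inl_injr x s : (inl x \in injr s) = false.
Proof. by apply/negP => /mapP []. Qed.
Lemma inr_injl i s : (inr i \in injl s) = false.
Proof. by apply/negP => /mapP []. Qed.

Lemma attach_rr (i j : 'I_m) : i <= j ->
  tpath attach (inr i) (inr j) (injr (seg i j)).
Proof.
move=> ij; have E : map val (rcons (seg i j) j) = iota i (j - i).+1.
  by rewrite map_rcons val_seg ?(ltnW (ltn_ord j)) // -addn1 iotaD /= cats1 subnKC.
apply/and3P; split.
- rewrite -map_rcons sorted_map.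
  have := sorted_iota i (j - i).+1; rewrite -E sorted_map.
  by apply: sub_sorted => a b /=.
- case/boolP: (i == j) => [/eqP -> |nij]; first by rewrite /seg subnn.
  have : head j (seg i j) = i.
    apply: val_inj; have := congr1 (head 0) E.
    by rewrite map_rcons; case: (seg i j) => //= ->.
  by case: (seg i j) => [|a s] /= -> .
- rewrite -map_rcons (map_inj_uniq inr_inj) -(map_inj_uniq val_inj) E.
  exact: iota_uniq.
Qed.

Lemma attach_rv (i : 'I_m) : tpath attach (inr i) (inl v) (injr (seg i m)).
Proof.
have im : i <= final by rewrite /= -ltnS prednK // ltnW.
have fm : final.+1 = m by rewrite /= prednK // ltnW.
rewrite (seg_rcons im fm) map_rcons.
apply: tpath_rcons; first exact: attach_rr.
- by rewrite /= eqxx; apply/eqP.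
- by rewrite -map_rcons inl_injr.
Qed.

Lemma attach_vr (j : 'I_m) : tpath attach (inl v) (inr j) (inl v :: injr (seg 0 j)).
Proof.
apply: (@tpath_cons _ _ _ (inr first)).
- exact: (@attach_rr first j).
- by rewrite /= !eqxx.
- by rewrite -map_rcons inl_injr.
Qed.

Lemma attach_ll x y t : tpath e x y t -> tpath attach (inl x) (inl y) (injl t).
Proof.
case/and3P => st hx ut; apply/and3P; split.
- by rewrite -map_rcons sorted_map.
- by case: (t) hx => /= [/eqP ->|a t' /eqP ->].
- by rewrite -map_rcons (map_inj_uniq inl_inj).
Qed.

Lemma attach_lr x t (j : 'I_m) : tpath e x v t ->
  tpath attach (inl x) (inr j) (injl t ++ inl v :: injr (seg 0 j)).
Proof.
move=> tx; apply: tpath_cat (attach_ll tx) (attach_vr j) _.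
apply/hasPn => -[y|i]; last by rewrite /= inr_injl.
rewrite rcons_cons in_cons -map_rcons inl_injr orbF => /eqP [->] /=.
rewrite (mem_map inl_inj); case/and3P: tx => _ _.
by rewrite rcons_uniq => /andP [].
Qed.

Lemma attach_rl y t (i : 'I_m) : tpath e v y t ->
  tpath attach (inr i) (inl y) (injr (seg i m) ++ injl t).
Proof.
move=> ty; apply: tpath_cat (attach_rv i) (attach_ll ty) _.
by apply/hasPn => -[z|k]; rewrite /= -map_rcons ?inl_injr // inr_injl.
Qed.

Lemma attach_rvr (i j : 'I_m) : j < i ->
  tpath attach (inr i) (inr j) (injr (seg i m) ++ inl v :: injr (seg 0 j)).
Proof.
move=> ji; apply: tpath_cat (attach_rv i) (attach_vr j) _.
apply/hasPn => -[z|k]; first by rewrite /= inl_injr.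
rewrite rcons_cons in_cons -map_rcons /= !(mem_map inr_inj) mem_rcons in_cons !mem_seg //; last first.
  exact: ltnW.
by move=> /orP [/eqP ->|]; lia.
Qed.

(** * Dicycles after attaching a cycle *)

Hypothesis irr : irreflexive e.

Let new_cycle := inl v :: injr (seg 0 m).
Let lift (C : {set T * T}) : {set (T + 'I_m) * (T + 'I_m)} :=
  [set (inl a.1, inl a.2) | a in C].

Lemma all_inl (s : seq (T + 'I_m)) : (forall i, inr i \notin s) -> exists s0, s = injl s0.
Proof.
elim: s => [|[x|i] s IHs] H; first by exists [::].
  have [|s0 ->] := IHs; last by exists (x :: s0).
  by move=> i; have := H i; rewrite in_cons negb_or => /andP [].
by have := H i; rewrite mem_head.
Qed.

Lemma attach_path_inl x p i : path attach (inl x) p -> inl v \notin inl x :: p ->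
  inr i \notin p.
Proof.
elim: p x => [|[y|j] p IHp] x //= /andP [exy ep]; rewrite in_cons negb_or => /andP [vx vp].
  by rewrite in_cons; apply: IHp ep vp.
by case/andP: exy vx => /eqP ->; rewrite eqxx.
Qed.

Lemma attach_path_inr (i : 'I_m) p : path attach (inr i) p -> inl v \notin p ->
  exists2 s : seq 'I_m, p = injr s & path (fun a b => b == a.+1) i (map val s).
Proof.
elim: p i => [|[y|j] p IHp] i /=; first by exists [::].
  by case/andP => /andP [/eqP -> _]; rewrite mem_head.
move=> /andP [ij ep]; rewrite in_cons /= => vp.
by have [s -> es] := IHp j ep vp; exists (j :: s); rewrite //= ij es.
Qed.

Lemma path_succ i s : path (fun a b => b == a.+1) i s -> s = iota i.+1 (size s).
Proof. by elim: s i => //= a s IHs i /andP [/eqP -> /IHs <-]. Qed.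

Lemma dicycle_new : dicycle attach (inl v) (injr (seg 0 m)).
Proof.
have /and3P [st /eqP hy ut] := attach_rv first.
rewrite /dicycle /= -[seg first m]/(seg 0 m) in st hy ut *.
move: ut; rewrite rcons_uniq => /andP [-> ->]; rewrite !andbT.
case: (injr (seg 0 m)) st hy => [|a s] //= + aE; rewrite aE => ->.
by rewrite eqxx.
Qed.

(** A dicycle missing [v] contains no new vertex: old vertices lead to new ones only through [v],
    and among new vertices the index only increases. A dicycle through [v] is rotated to start
    there; its first step decides whether it stays old or runs round the new cycle. *)
Lemma attach_dicycle a c : dicycle attach a c ->
  (exists x c0, [/\ a = inl x, c = injl c0 & dicycle e x c0]) \/
  cycle_arcs (a :: c) = cycle_arcs new_cycle.
Proof.
case/andP => ep uc.
have old : (forall i, inr i \notin a :: c) ->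
    exists x c0, [/\ a = inl x, c = injl c0 & dicycle e x c0].
  move=> /all_inl [[|x c0] //= [aE cE]]; exists x, c0; split=> //.
  move: ep uc; rewrite aE cE -map_rcons path_map -map_cons (map_inj_uniq inl_inj).
  by rewrite /dicycle => -> ->.
have [va|va] := boolP (inl v \in a :: c); last first.
  left; apply: old => i; case: a ep uc va => [x|j] ep uc va.
    have vs : inl v \notin inl x :: rcons c (inl x).
      by move: va; rewrite !(in_cons, mem_rcons) !negb_or => /andP [-> ->].
    have := attach_path_inl i ep vs.
    by rewrite mem_rcons.
  have [|s sE /path_succ es] := attach_path_inr ep; first by rewrite mem_rcons.
  have : inr j \in injr s by rewrite -sE mem_rcons mem_head.
  rewrite (mem_map inr_inj) -(mem_map val_inj) es mem_iota /=; lia.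
have [k d dE] := rot_to va.
have : dicycle attach (inl v) d.
  by rewrite /dicycle -[path _ _ _]/(cycle attach (inl v :: d)) -dE rot_cycle rot_uniq /= ep.
have {dE} [memd arcd] : a :: c =i inl v :: d /\ cycle_arcs (a :: c) = cycle_arcs (inl v :: d).
  by rewrite -dE; split; [move=> z; rewrite mem_rot | rewrite cycle_arcs_rot].
case: d memd arcd => [|[x|j] d] memd arcd /andP [].
- by rewrite /= irr.
- move=> /= /andP [_ ed] /andP [vd ud]; left; apply: old => i; rewrite memd !in_cons /=.
  apply: attach_path_inl; last by exact: vd.
  by move: ed; rewrite rcons_path => /andP [ed _]; apply: ed.
move=> /= /andP [/andP [_ j0]]; rewrite rcons_path => /andP [ed ld] /andP [vd ud]; right.
have [|s dE es] := attach_path_inr ed; first by move: vd; rewrite in_cons negb_or => /andP [].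
rewrite arcd dE /new_cycle -map_cons; congr (cycle_arcs (_ :: injr _)).
apply: (inj_map val_inj); rewrite val_seg // subn0 /= (path_succ es) (eqP j0) size_map.
suff mE : m = (size s).+1 by rewrite [X in _ = iota 0 X]mE.
move: ld; rewrite dE last_map /= eqxx /= => /eqP mE; apply: etrans (esym mE) _; congr _.+1.
have := last_map val s j; rewrite (path_succ es) (eqP j0) size_map /= => <-.
by case: (size s) => [|n]; [apply/eqP | rewrite (last_nth 0) size_iota -[LHS]/(nth 0 (iota 1 n.+1) n) nth_iota].
Qed.

Lemma cycle_arcs_lift s : uniq s -> cycle_arcs (injl s) = lift (cycle_arcs s).
Proof.
move=> us; apply/setP => z; apply/imsetP/imsetP => [[b]|[b /imsetP [x xs ->] ->]].
  case/mapP => x xs -> ->; exists (x, next s x); first by apply/imsetP; exists x.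
  by rewrite (next_map inl_inj).
by exists (inl x); rewrite ?(map_f _ xs) // (next_map inl_inj).
Qed.

Lemma dicycles_attach :
  dicycles attach = cycle_arcs new_cycle |: [set lift C | C in dicycles e].
Proof.
apply/setP => C; rewrite in_setU1; apply/dicyclesP/orP => [[a [c [ac ->]]]|].
  have [[x [c0 [aE cE xc0]]]|->] := attach_dicycle ac; last by left.
  right; apply/imsetP; exists (cycle_arcs (x :: c0)); first by apply/dicyclesP; exists x, c0.
  by rewrite aE cE -cycle_arcs_lift //; case/andP: xc0.
case=> [/eqP ->|/imsetP [D /dicyclesP [x [c [/andP [ec uc] ->]]] ->]].
  by exists (inl v), (injr (seg 0 m)); split=> //; apply: dicycle_new.
exists (inl x), (injl c); split; last by rewrite -cycle_arcs_lift.
by rewrite /dicycle -map_rcons path_map ec -[inl x :: _]/(injl (x :: c)) (map_inj_uniq inl_inj).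
Qed.

(** The arcs with at least one new end; [new_arcs] identifies them with those of the new cycle. *)
Definition new_arc (a b : T + 'I_m) : bool :=
  attach a b && ~~ (if a is inl _ then if b is inl _ then true else false else false).

Lemma new_arc_det a b b' : new_arc a b -> new_arc a b' -> b = b'.
Proof.
case: a b b' => [x|i] [y|j] [y'|j'] //=; rewrite /new_arc /= ?andbF ?andbT //.
- by move=> /andP [_ /eqP jE] /andP [_ /eqP j'E]; congr inr; apply: val_inj; rewrite /= jE.
- by move=> /andP [/eqP -> _] /andP [/eqP -> _].
- by move=> /andP [_ /eqP iE] /eqP jE; have := ltn_ord j'; rewrite jE iE ltnn.
- by move=> /eqP jE /andP [_ /eqP iE]; have := ltn_ord j; rewrite jE iE ltnn.
- by move=> /eqP jE /eqP j'E; congr inr; apply: val_inj; rewrite /= jE.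
Qed.

Lemma new_arcs a b : ((a, b) \in cycle_arcs new_cycle) = new_arc a b.
Proof.
have /andP [en un] := dicycle_new.
have nextP z : z \in new_cycle -> new_arc z (next new_cycle z).
  move=> zn; have ez := next_cycle (en : cycle attach new_cycle) zn.
  rewrite /new_arc ez; case: z zn ez => // x xn.
  have := mem_next new_cycle (inl x); rewrite xn; case: (next _ _) => // y.
  move: xn; rewrite !in_cons !inl_injr !orbF => /eqP [->] /eqP [->] /=.
  by rewrite irr.
apply/imsetP/idP => [[z zn [-> ->]]|ab]; first exact: nextP.
have an : a \in new_cycle.
  case: a ab => [x|i] /andP []; last by rewrite in_cons /= (mem_map inr_inj) mem_seg ?ltn_ord.
  by case: b => // j /= /andP [/eqP ->]; rewrite mem_head.
by exists a => //; rewrite (new_arc_det ab (nextP a an)).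
Qed.

Lemma lift_arc C a b : (a, b) \in lift C -> exists x y, [/\ a = inl x, b = inl y & (x, y) \in C].
Proof. by case/imsetP => [[x y] xy [-> ->]]; exists x, y. Qed.

Lemma lift_inj : injective lift.
Proof.
apply: imset_inj => -[x y] [x' y'] /= [-> ->]; by [].
Qed.

Theorem attach_nq_cactus n q : nq_cactus n q e -> nq_cactus (n + m) q.+1 attach.
Proof.
case=> -[sc [_ asym] unq] nE qE; split; last first.
- rewrite dicycles_attach cardsU1 (card_imset _ lift_inj) qE.
  suff -> : cycle_arcs new_cycle \notin [set lift C | C in dicycles e] by [].
  apply/negP => /imsetP [C _ CE].
  have : (inl v, inr first) \in cycle_arcs new_cycle by rewrite new_arcs /new_arc /= !eqxx.
  by rewrite CE => /lift_arc [x [y []]].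
- by rewrite card_sum card_ord nE.
split.
- have sct x y : exists t, tpath e x y t.
    have [p dp] := strong_dipath x y sc; exists (belast x p); exact: dipath_tpath.
  have con a b t : tpath attach a b t -> connect attach a b.
    case/tpath_dipath => p [ep lp _] _; by apply/connectP; exists p.
  case=> [x|i] [y|j].
  + have [t /attach_ll] := sct x y; exact: con.
  + have [t /(attach_lr j)] := sct x v; exact: con.
  + have [t /(attach_rl i)] := sct v y; exact: con.
  + case: (leqP i j) => [/attach_rr|/attach_rvr]; exact: con.
- split; first by case=> [x|i] /=; [rewrite irr | rewrite -[_ == _]/(_ == _) ltn_eqF].
  case=> [x|i] [y|j] //=.
  + by move/asym ->.
  + move=> /andP [/andP [_ /eqP ->] /andP [_ /eqP mE]]; move: m_gt1; lia.
  + move=> /andP [/andP [_ /eqP mE] /andP [_ /eqP i0]]; move: m_gt1; lia.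
  + move=> /andP [/eqP jE /eqP iE]; lia.
move=> a b ab.
have [old|new] := boolP (new_arc a b).
  exists (cycle_arcs new_cycle); split.
    by rewrite dicycles_attach setU11 new_arcs.
  move=> C []; rewrite dicycles_attach in_setU1 => /orP [/eqP -> //|/imsetP [D _ ->]].
  by move=> /lift_arc [x [y [aE bE _]]]; move: old; rewrite aE bE /new_arc andbF.
case: a b ab new => [x|i] [y|j] ab; rewrite /new_arc ab //= => new.
have [C [[dC Cxy] Cun]] := unq x y ab.
exists (lift C); split.
  by rewrite dicycles_attach in_setU1 imset_f ?orbT //; split=> //; apply/imsetP; exists (x, y).
move=> D []; rewrite dicycles_attach in_setU1 => /orP [/eqP -> |/imsetP [D' dD' ->]].
  by rewrite new_arcs /new_arc andbF.
by case/lift_arc => x' [y' [[xE] [yE] D'xy]]; rewrite (Cun D') // xE yE.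
Qed.

End Attach.

(** * Colourings that extend along an attached cycle *)

(* Colours of dipaths through the gate v in a graph to which cycles are to be
   attached at v. The colours pv (of a vertex) and pt (of tails) are not used
   on dipaths leaving v, so the last vertex of an attached cycle may take them;
   sg is not used inside dipaths arriving at v, so its first vertex may take it. *)
Record gate_path (T : finType) (e : rel T) (v : T) (cv ct : T -> nat)
    (pv pt sg : nat) (x y : T) (t : seq T) : Prop := GatePath {
  gp_path : tpath e x y t;
  gp_ct : uniq (map ct t);
  gp_cv : uniq (map cv (behead t));
  gp_from : x = v -> (pt \notin map ct t) && (pv \notin map cv t);
  gp_to : y = v -> sg \notin map cv (behead t) }.

(** The gate has both of its colours to itself. The reserved colours may lie beyond the ranges [kv]
    and [kt], as they do for the one-point graph that starts the construction. *)
Record gate_colouring (T : finType) (e : rel T) (v : T) (cv ct : T -> nat)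
    (kv kt pv pt sg : nat) : Prop := GateColouring {
  gc_cv : forall x, cv x < kv;
  gc_ct : forall x, ct x < kt;
  gc_gate : [&& pv != cv v, pt != ct v, sg != cv v & sg != pv];
  gc_cv_gate : forall x, cv x = cv v -> x = v;
  gc_ct_gate : forall x, ct x = ct v -> x = v;
  gc_path : forall x y, exists t, gate_path e v cv ct pv pt sg x y t }.

Section AttachColouring.

Variables (T : finType) (e : rel T) (v : T) (cv ct : T -> nat) (kv kt pv pt sg : nat).
Hypothesis col : gate_colouring e v cv ct kv kt pv pt sg.
Variables (m : nat) (b a : nat -> nat) (kv' kt' : nat).
Hypotheses (m_gt1 : 1 < m) (le_kv : kv <= kv') (le_kt : kt <= kt').
Hypotheses (a_lt : forall i, i < m -> a i < kt') (b_lt : forall i, i < m -> b i < kv').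
Hypothesis a_inj : {in [pred i | i < m] &, injective a}.
Hypothesis b_inj : {in [pred i | i < m] &, injective b}.
(** Old colours are reused only where this is safe: a dipath with the last new vertex as a tail goes
    on to the gate and leaves it, and one with the first new vertex inside has come through the
    gate. *)
Hypothesis a_new : forall i, i < m -> (kt <= a i) || (i.+1 == m) && (a i == pt).
Hypothesis b_new : forall i, i < m ->
  [|| kv <= b i, (i == 0) && (b i == sg) | (i.+1 == m) && (b i == pv)].

Let e' := @attach T e v m.
Definition attach_col (c : T -> nat) (d : nat -> nat) : T + 'I_m -> nat :=
  fun z => match z with inl x => c x | inr i => d i end.
Let cv' := attach_col cv b.
Let ct' := attach_col ct a.
Let old := gate_path e v cv ct pv pt sg.

Notation injl := (map (@inl T 'I_m)).
Notation injr := (map (@inr T 'I_m)).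

Lemma attach_col_l c d s : map (attach_col c d) (injl s) = map c s.
Proof. by rewrite -map_comp. Qed.

Lemma attach_col_r c d i j : j <= m ->
  map (attach_col c d) (injr (seg m i j)) = map d (iota i (j - i)).
Proof. by move=> jm; rewrite -(val_seg i jm) -!map_comp. Qed.

Lemma a_uniq i j : j <= m -> uniq (map a (iota i (j - i))).
Proof.
move=> jm; rewrite map_inj_in_uniq ?iota_uniq // => k l.
by rewrite !mem_iota => hk hl; apply: a_inj; rewrite inE; lia.
Qed.

Lemma b_uniq i j : j <= m -> uniq (map b (iota i (j - i))).
Proof.
move=> jm; rewrite map_inj_in_uniq ?iota_uniq // => k l.
by rewrite !mem_iota => hk hl; apply: b_inj; rewrite inE; lia.
Qed.

Lemma old_lt (c : T -> nat) k s n : (forall x, c x < k) -> n \in map c s -> n < k.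
Proof. by move=> ck /mapP [x _ ->]. Qed.

Lemma a_mem i s : i < m -> a i \in map ct s -> i.+1 = m /\ a i = pt.
Proof.
move=> im /(old_lt (gc_ct col)); rewrite ltnNge => /negbTE ak.
by have := a_new im; rewrite ak /= => /andP [/eqP -> /eqP].
Qed.

Lemma b_mem i s : i < m -> b i \in map cv s -> i = 0 /\ b i = sg \/ i.+1 = m /\ b i = pv.
Proof.
move=> im /(old_lt (gc_cv col)); rewrite ltnNge => /negbTE bk.
by have := b_new im; rewrite bk /= => /orP [/andP [/eqP ? /eqP ?]|/andP [/eqP ? /eqP ?]]; [left | right].
Qed.

Lemma a_gate i : i < m -> a i != ct v.
Proof.
move=> im; apply/eqP => ai; have /and4P [_ + _ _] := gc_gate col.
have [_ <-] : i.+1 = m /\ a i = pt by apply: (@a_mem i [:: v]); rewrite // inE ai.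
by rewrite ai eqxx.
Qed.

Lemma b_gate i : i < m -> b i != cv v.
Proof.
move=> im; apply/eqP => bi; have /and4P [nv _ ns _] := gc_gate col.
have bm : b i \in map cv [:: v] by rewrite inE bi.
have [[_ bE]|[_ bE]] := b_mem im bm.
  by rewrite -bE bi eqxx in ns.
by rewrite -bE bi eqxx in nv.
Qed.

(** The shape of the tail list in each of the four cases, recorded so that the colours on it can be
    read off once the next gate is chosen. *)
Definition attach_path (z z' : T + 'I_m) (t : seq (T + 'I_m)) : Prop :=
  match z, z' with
  | inl x, inl y => exists2 s, old x y s & t = injl s
  | inl x, inr j => exists2 s, old x v s & t = injl s ++ inl v :: injr (seg m 0 j)
  | inr i, inl y => exists2 s, old v y s & t = injr (seg m i m) ++ injl s
  | inr i, inr j => t = if i <= j then injr (seg m i j)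
                        else injr (seg m i m) ++ inl v :: injr (seg m 0 j)
  end.

Lemma old_loop s : old v v s -> s = [::].
Proof. by case=> /tpath_loop. Qed.

Lemma seg_behead (i : 'I_m) j : i < j -> j <= m ->
  seg m i j = i :: seg m i.+1 j.
Proof.
move=> ij jm; apply: (inj_map val_inj); rewrite /= !val_seg //.
by have -> : j - i = (j - i.+1).+1 by lia.
Qed.

Lemma gate_ct_notin x s : old x v s -> ct v \notin map ct s.
Proof.
case=> /and3P [_ _ +] _ _ _ _; rewrite rcons_uniq => /andP [vs _].
by apply: contra vs => /mapP [z zs /esym /(gc_ct_gate col) <-].
Qed.

Lemma gate_cv_notin x s : old x v s -> cv v \notin map cv (behead s).
Proof.
case=> /and3P [_ _ +] _ _ _ _; rewrite rcons_uniq => /andP [vs _].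
by apply: contra vs => /mapP [z /mem_behead zs /esym /(gc_cv_gate col) <-].
Qed.

Lemma gate_cv_uniq y s : old v y s -> uniq (map cv s).
Proof.
case=> ps _ us _ _; have [vy|vy] := eqVneq v y.
  by move: ps; rewrite -vy => /tpath_loop ->.
have sE := tpath_head ps vy; rewrite sE /= us andbT.
case/and3P: ps => _ _; rewrite sE /= mem_rcons in_cons negb_or => /andP [/andP [_ vs] _].
by apply: contra vs => /mapP [z zs /esym /(gc_cv_gate col) <-].
Qed.

Lemma a_gate_notin i j : j <= m -> ct v \notin map a (iota i (j - i)).
Proof.
move=> jm; apply/negP => /mapP [k]; rewrite mem_iota => ki /eqP.
by rewrite eq_sym (negbTE (a_gate _)) //; lia.
Qed.

Lemma b_gate_notin i j : j <= m -> cv v \notin map b (iota i (j - i)).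
Proof.
move=> jm; apply/negP => /mapP [k]; rewrite mem_iota => ki /eqP.
by rewrite eq_sym (negbTE (b_gate _)) //; lia.
Qed.

Lemma attach_colouring z z' : exists t,
  [/\ tpath e' z z' t, attach_path z z' t, uniq (map ct' t) & uniq (map cv' (behead t))].
Proof.
case: z z' => [x|i] [y|j].
- have [s os] := gc_path col x y; exists (injl s); split.
  + exact: attach_ll (gp_path os).
  + by exists s.
  + by rewrite attach_col_l (gp_ct os).
  + by rewrite -behead_map attach_col_l behead_map (gp_cv os).
- have [s os] := gc_path col x v; have jm := ltnW (ltn_ord j).
  exists (injl s ++ inl v :: injr (seg m 0 j)); split.
  + exact: attach_lr (gp_path os).
  + by exists s.
  + rewrite map_cat /= attach_col_l attach_col_r // cat_uniq (gp_ct os) /= a_uniq // andbT.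
    rewrite !negb_or (gate_ct_notin os) /= a_gate_notin // andbT.
    apply/hasPn => _ /mapP [k + ->]; rewrite mem_iota => kj; apply/negP => /= /a_mem.
    by have := ltn_ord j; lia.
  + case: s os => [|s0 s] os /=.
      by rewrite attach_col_r // b_uniq.
    rewrite map_cat /= attach_col_l attach_col_r // cat_uniq (gp_cv os) /= b_uniq // andbT.
    rewrite !negb_or (gate_cv_notin os) /= b_gate_notin // andbT.
    apply/hasPn => _ /mapP [k + ->]; rewrite mem_iota => kj; apply/negP => /= bk.
    have km : k < m by have := ltn_ord j; lia.
    have [[_ bE]|[kE _]] := b_mem km bk; last by have := ltn_ord j; lia.
    by have := gp_to os erefl; rewrite -bE bk.
- have [s os] := gc_path col v y; have im := ltn_ord i.
  exists (injr (seg m i m) ++ injl s); split.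
  + exact: attach_rl (gp_path os).
  + by exists s.
  + rewrite map_cat /= attach_col_l attach_col_r // cat_uniq (gp_ct os) /= a_uniq // andbT.
    apply/hasPn => c cs; apply/negP => /= /mapP [k + cE]; rewrite mem_iota => ki.
    rewrite cE in cs; have [|km aE] := a_mem _ cs; first by lia.
    by have /andP [] := gp_from os erefl; rewrite -aE cs.
  + rewrite seg_behead //= map_cat /= attach_col_l attach_col_r // cat_uniq b_uniq // andTb.
    rewrite (gate_cv_uniq os) andbT.
    apply/hasPn => c cs; apply/negP => /= /mapP [k + cE]; rewrite mem_iota => ki.
    have km : k < m by lia.
    rewrite cE in cs; have [[k0 _]|[_ bE]] := b_mem km cs; first by lia.
    by have /andP [_] := gp_from os erefl; rewrite -bE cs.
- have jm := ltnW (ltn_ord j); rewrite /=; case: leqP => ij.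
    exists (injr (seg m i j)); split => //; first exact: attach_rr.
      by rewrite attach_col_r // a_uniq.
    by rewrite -behead_map attach_col_r // -drop1 drop_uniq // b_uniq.
  exists (injr (seg m i m) ++ inl v :: injr (seg m 0 j)); split => //; first exact: attach_rvr.
    rewrite map_cat /= !attach_col_r // cat_uniq /= !a_uniq // andbT negb_or.
    rewrite (a_gate_notin _ (leqnn m)) (a_gate_notin 0 jm) /= andbT.
    apply/hasPn => _ /mapP [k + ->]; rewrite mem_iota => kj.
    apply/negP => /= /mapP [l]; rewrite mem_iota => li /a_inj; rewrite !inE.
    by move=> H; have := ltn_ord i; have := H; lia.
  rewrite seg_behead //= map_cat /= !attach_col_r // cat_uniq /= !b_uniq // andbT negb_or.
  rewrite (b_gate_notin _ (leqnn m)) (b_gate_notin 0 jm) /= andbT.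
  apply/hasPn => _ /mapP [k + ->]; rewrite mem_iota => kj.
  apply/negP => /= /mapP [l]; rewrite mem_iota => li /b_inj; rewrite !inE.
  by move=> H; have := ltn_ord i; have := H; lia.
Qed.

Lemma map_a_notin c i j : j <= m -> (forall l, i <= l < j -> a l != c) ->
  c \notin map a (iota i (j - i)).
Proof.
move=> jm ac; apply/negP => /mapP [l]; rewrite mem_iota => li /eqP.
by rewrite eq_sym (negbTE (ac l _)) //; lia.
Qed.

Lemma map_b_notin c i j : j <= m -> (forall l, i <= l < j -> b l != c) ->
  c \notin map b (iota i (j - i)).
Proof.
move=> jm bc; apply/negP => /mapP [l]; rewrite mem_iota => li /eqP.
by rewrite eq_sym (negbTE (bc l _)) //; lia.
Qed.

Lemma a_neq k l : k < m -> l < m -> k != l -> a k != a l.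
Proof. by move=> km lm; apply: contraNneq => /a_inj -> //; rewrite inE. Qed.

Lemma b_neq k l : k < m -> l < m -> k != l -> b k != b l.
Proof. by move=> km lm; apply: contraNneq => /b_inj -> //; rewrite inE. Qed.

Lemma attach_cv_lt z : cv' z < kv'.
Proof. by case: z => [x|i] /=; [apply: leq_trans (gc_cv col x) le_kv | apply: b_lt]. Qed.

Lemma attach_ct_lt z : ct' z < kt'.
Proof. by case: z => [x|i] /=; [apply: leq_trans (gc_ct col x) le_kt | apply: a_lt]. Qed.

(** The gate stays at [v]. No dipath leaving it has the last new vertex as a tail, and no dipath
    ending at it has the first new vertex inside, so the colours of these two become the reserved
    ones. *)
Lemma attach_gate_colouring :
  gate_colouring e' (inl v) cv' ct' kv' kt' (b m.-1) (a m.-1) (b 0).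
Proof.
have m1 : m.-1 < m by lia.
have m0 : 0 < m by lia.
split; [exact: attach_cv_lt | exact: attach_ct_lt | | | |].
- by rewrite b_gate // a_gate // b_gate // b_neq //; lia.
- case=> [x|i] /= => [/(gc_cv_gate col) -> //|/eqP].
  by rewrite (negbTE (b_gate _)).
- case=> [x|i] /= => [/(gc_ct_gate col) -> //|/eqP].
  by rewrite (negbTE (a_gate _)).
move=> z z'; have [t [pt' at' ut uv]] := attach_colouring z z'; exists t; split=> //.
- move=> zv; rewrite zv in at'; case: z' at' {pt'} => [y|j] /= [s os tE].
    rewrite tE !attach_col_l; have /andP [npt npv] := gp_from os erefl.
    apply/andP; split; apply/negP.
      by move=> am; have [_ aE] := a_mem m1 am; rewrite aE (negbTE npt) in am.
    move=> bm; have [[]|[_ bE]] := b_mem m1 bm; first by lia.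
    by rewrite bE (negbTE npv) in bm.
  have jm := ltn_ord j.
  rewrite tE (old_loop os) /= !attach_col_r ?(ltnW jm) // !in_cons !negb_or.
  rewrite a_gate // b_gate //=; apply/andP; split.
    by apply: map_a_notin => [|l hl]; [exact: ltnW | apply: a_neq; lia].
  by apply: map_b_notin => [|l hl]; [exact: ltnW | apply: b_neq; lia].
- move=> zv; rewrite zv in at'; case: z at' {pt'} => [x|i] /= [s os tE].
    rewrite tE -behead_map attach_col_l behead_map; apply/negP => bm.
    have [[_ bE]|[]] := b_mem m0 bm; last by lia.
    by have := gp_to os erefl; rewrite -bE bm.
  rewrite tE (old_loop os) cats0 seg_behead ?ltn_ord //= attach_col_r //.
  by apply: map_b_notin => // l hl; apply: b_neq; lia.
Qed.

(** The gate moves to [g]. Dipaths from [g] have as new tails the vertices from [g] on and, beyond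
    [v], those up to [g - 2]; so the colours of [g - 1] are candidates for [pv'] and [pt']. *)
Lemma attach_new_gate_colouring (g : 'I_m) pv' pt' :
  kv <= b g -> kt <= a g ->
  (pv' == pv) || (kv <= pv') -> (pt' == pt) || (kt <= pt') ->
  (forall l, (g <= l < m) || (l.+1 < g) -> (b l != pv') && (a l != pt')) ->
  (forall l, l < m -> b l != sg) -> sg != pv' ->
  gate_colouring e' (inr g) cv' ct' kv' kt' pv' pt' sg.
Proof.
move=> bg ag npv npt nb nsg sgpv; have gm := ltn_ord g.
have nba l : (g <= l < m) || (l.+1 < g) -> a l != pt' by case/nb/andP.
have nbb l : (g <= l < m) || (l.+1 < g) -> b l != pv' by case/nb/andP.
have /and4P [pvv ptv sgv sgpv0] := gc_gate col.
have pv'v : pv' != cv v.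
  by case/orP: npv => [/eqP -> //|h]; rewrite gtn_eqF // (leq_trans (gc_cv col v)).
have pt'v : pt' != ct v.
  by case/orP: npt => [/eqP -> //|h]; rewrite gtn_eqF // (leq_trans (gc_ct col v)).
split; [exact: attach_cv_lt | exact: attach_ct_lt | | | |].
- have /andP [b1 a1] : (b g != pv') && (a g != pt') by apply: nb; rewrite leqnn gm.
  by rewrite /= eq_sym b1 eq_sym a1 eq_sym nsg.
- case=> [x|i] /= => [cE|/b_inj iE]; first by have := gc_cv col x; rewrite cE ltnNge bg.
  by congr inr; apply: val_inj; apply: iE; rewrite inE.
- case=> [x|i] /= => [cE|/a_inj iE]; first by have := gc_ct col x; rewrite cE ltnNge ag.
  by congr inr; apply: val_inj; apply: iE; rewrite inE.
move=> z z'; have [t [ptt at' ut uv]] := attach_colouring z z'; exists t; split=> //.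
- move=> zg; rewrite zg in at'; case: z' at' {ptt} => [y|j] /=.
    case=> s os tE; rewrite tE !map_cat !attach_col_l !attach_col_r // !mem_cat !negb_or.
    have /andP [n1 n2] := gp_from os erefl.
    apply/andP; split; apply/andP; split.
    + by apply: map_a_notin => // l hl; apply: nba; lia.
    + case/orP: npt => [/eqP -> //|h]; apply/negP => /(old_lt (gc_ct col)); lia.
    + by apply: map_b_notin => // l hl; apply: nbb; lia.
    + case/orP: npv => [/eqP -> //|h]; apply/negP => /(old_lt (gc_cv col)); lia.
  have jm := ltn_ord j; case: leqP => gj ->.
    rewrite !attach_col_r ?(ltnW jm) //; apply/andP; split.
      by apply: map_a_notin => [|l hl]; [exact: ltnW | apply: nba; lia].
    by apply: map_b_notin => [|l hl]; [exact: ltnW | apply: nbb; lia].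
  rewrite !map_cat /= !attach_col_r ?(ltnW jm) // !mem_cat !in_cons !negb_or pv'v pt'v /=.
  apply/andP; split; apply/andP; split.
  + by apply: map_a_notin => // l hl; apply: nba; lia.
  + by apply: (@map_a_notin _ 0 j) => [|l hl]; [exact: ltnW | apply: nba; lia].
  + by apply: map_b_notin => // l hl; apply: nbb; lia.
  + by apply: (@map_b_notin _ 0 j) => [|l hl]; [exact: ltnW | apply: nbb; lia].
- have nsgs i j : j <= m -> sg \notin map b (iota i (j - i)).
    by move=> jm; apply: map_b_notin => // l hl; apply: nsg; lia.
  have nsg0 : sg \notin map b (iota 0 (g - 0)) by apply: nsgs; apply: ltnW.
  move=> zg; rewrite zg in at'; case: z at' {ptt} => [x|i] /=.
    case=> -[|s0 s] os ->; first by rewrite /= attach_col_r ?(ltnW gm).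
    rewrite /= map_cat /= attach_col_l attach_col_r ?(ltnW gm) // mem_cat in_cons !negb_or.
    by rewrite nsg0 (gp_to os erefl) sgv.
  move=> tE; suff : sg \notin map cv' t.
    by apply: contra; rewrite -behead_map => /mem_behead.
  rewrite tE; case: leqP => _; first by rewrite attach_col_r ?nsgs // ltnW.
  by rewrite map_cat /= !attach_col_r ?(ltnW gm) // mem_cat in_cons !negb_or nsgs // sgv.
Qed.

End AttachColouring.

(** * Lower bounds *)

Section Fan.

Variables (T : finType) (e : rel T) (v y : T) (t : seq T) (ds : seq (T * T)).

(** Each [z] in [ds] stands for a triangle at [v] whose middle arc runs from [z.1] to [z.2]. *)
Definition fan : Prop :=
  [/\ tpath e v y t, 0 < size t, uniq ds,
      forall z, z \in ds -> [/\ e v z.1, e z.1 z.2, e z.2 v, z.1 \notin rcons t y & z.2 \notin rcons t y] &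
      forall z z', z \in ds -> z' \in ds -> z != z' -> uniq [:: z.1; z.2; z'.1; z'.2]].

Hypotheses (cactus_e : cactus e) (fan_ds : fan) (ds_gt0 : 0 < size ds).

Let uniq_dp : unique_dipaths e := cactus_unique_dipaths cactus_e.

Lemma fan_gate : v \in rcons t y.
Proof.
case: fan_ds => /and3P [_ /eqP hy _] + _ _ _.
by case: t hy => //= a t' -> _; rewrite mem_head.
Qed.

Lemma fan_neq z : z \in ds -> [/\ z.1 != v, z.2 != v & z.1 != z.2].
Proof.
case: fan_ds => _ _ _ H _ /H [_ e12 _ n1 n2]; split.
- by apply: contraNneq n1 => ->; apply: fan_gate.
- by apply: contraNneq n2 => ->; apply: fan_gate.
- by apply: contraTneq e12 => ->; rewrite cactus_irr.
Qed.

Lemma fan_dipath : exists l, [/\ dipath e v y l, size l = size t &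
  forall z, z \in ds -> dipath e z.1 y (z.2 :: v :: l)].
Proof.
have [pt t0 ud H Q] := fan_ds; have [l dl lt] := tpath_dipath pt.
exists l; split=> // [|z zd]; first by rewrite -lt size_belast.
have [ev e12 e2 n1 n2] := H _ zd; have [_ _ n12] := fan_neq zd.
have lE : v :: l = rcons t y by rewrite -lt; case: dl => _ <- _; rewrite -lastI.
apply: dipath_cons => //; first apply: dipath_cons => //; first by rewrite lE.
by rewrite in_cons negb_or n12 lE.
Qed.

Lemma fan_cross z z' : z \in ds -> z' \in ds -> z != z' ->
  dipath e z.1 z'.2 [:: z.2; v; z'.1; z'.2].
Proof.
move=> zd z'd zz'; have [_ _ _ H Q] := fan_ds.
have [ev e12 e2 n1 n2] := H _ zd; have [ev' e12' e2' n1' n2'] := H _ z'd.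
have [a1 a2 a12] := fan_neq zd; have [b1 b2 b12] := fan_neq z'd.
split=> //=; first by rewrite e12 e2 ev' e12'.
have := Q _ _ zd z'd zz'; rewrite /= !inE !negb_or.
by rewrite a1 a2 ![v == _]eq_sym b1 b2 /= => /and3P [/and3P [-> -> ->] /andP [-> ->] ->].
Qed.

(** The dipath from [z.1] to [y] has as internal vertices [z.2], [v] and the [size t - 1] internal
    ones of the dipath from [v]. *)
Lemma fan_rvc k : rvc_colourable e k -> (size t).+1 <= k.
Proof.
move=> [c rc]; have [l [dl szl dz]] := fan_dipath.
case: ds ds_gt0 dz => // z ds' _ /(_ z (mem_head _ _)) dz.
have [p dp] := rc z.1 y; rewrite (uniq_dp dp dz) => /card_uniqP uE.
rewrite -[k]card_ord; apply: leq_trans (max_card (mem (map c (internal z.1 (z.2 :: v :: l))))).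
by rewrite uE size_map /internal /= size_belast szl.
Qed.

(** The dipath from [z0.1] to [y] carries [size t + 2] arcs and [size t + 1] internal vertices, all
    of different colours. The middle arcs of the other triangles add [size ds - 1] further
    colours. *)
Lemma fan_trc k : trc_colourable e k -> 2 * (size t).+1 + size ds <= k.
Proof.
move=> [cv [ca rc]]; have [l [dl szl dz]] := fan_dipath.
have R x x' p : dipath e x x' p -> uniq (pairmap ca x p ++ map cv (internal x p)).
  by move=> dp; have [p' dp'] := rc x x'; rewrite (uniq_dp dp' dp).
have [z0 [ds' dsE]] : exists z0 ds', ds = z0 :: ds' by case: ds ds_gt0 => // z0 ds' _; exists z0, ds'.
have z0d : z0 \in ds by rewrite dsE mem_head.
have sub z : z \in ds' -> z \in ds by rewrite dsE in_cons => ->; rewrite orbT.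
have [_ _ ud _ _] := fan_ds; rewrite dsE /= in ud; have {ud} /andP [z0ds' ud'] := ud.
pose main := pairmap ca z0.1 (z0.2 :: v :: l) ++ map cv (internal z0.1 (z0.2 :: v :: l)).
pose extra := [seq ca z.1 z.2 | z <- ds'].
have cross z z' : z \in ds -> z' \in ds -> z != z' -> ca z.1 z.2 != ca z'.1 z'.2.
  move=> zd z'd zz'; have := R _ _ _ (fan_cross zd z'd zz').
  by rewrite /= !inE !negb_or => /andP [/and4P [_ _ -> _] _].
(* The middle arc of [z] is compared with the elements of [main] before [v] along the dipath from
   [z0.1] to [z.2], and with the rest along the one from [z.1] to [y]. *)
have notin z : z \in ds' -> ca z.1 z.2 \notin main.
  move=> zd'; have zd := sub _ zd'.
  have zz0 : z0 != z by apply: contraNneq z0ds' => ->.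
  have R1 := R _ _ _ (fan_cross z0d zd zz0); rewrite /= !inE !negb_or in R1.
  have /and5P [/and4P [_ _ n1 _] /and4P [_ n2 _ _] _ /and3P [n3 _ _] _] := R1.
  have R2 := R _ _ _ (dz _ zd); rewrite /internal /= !(mem_cat, inE) !negb_or in R2.
  have /and3P [/and4P [_ n4 _ n5] _ _] := R2.
  have -> : main = [:: ca z0.1 z0.2, ca z0.2 v & pairmap ca v l ++ cv z0.2 :: map cv (belast v l)].
    by [].
  rewrite !(mem_cat, inE) !negb_or n4 n5 andbT.
  by rewrite eq_sym n1 eq_sym n2 n3.
have um : uniq (main ++ extra).
  rewrite cat_uniq (R _ _ _ (dz _ z0d)) andTb; apply/andP; split.
    by apply/hasPn => _ /mapP [z zd' ->]; apply: notin.
  rewrite map_inj_in_uniq // => z z' /sub zd /sub z'd caE; apply/eqP; apply/negP => /negP zz'.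
  by have := cross _ _ zd z'd zz'; rewrite caE eqxx.
have <- : size (main ++ extra) = 2 * (size t).+1 + size ds.
  rewrite !size_cat size_pairmap !size_map /internal /= size_belast szl dsE /=; lia.
by move/card_uniqP: um => <-; rewrite -[k in _ <= k]card_ord max_card.
Qed.

End Fan.

(** * The extremal cacti *)

Lemma size_seg m i j : j <= m -> size (seg m i j) = j - i.
Proof. by move=> jm; rewrite -(size_map val) val_seg // size_iota. Qed.

(* N is the length of a dipath from the gate, d the number of final triangles. *)
Definition fan_cactus (n q N d : nat) : Prop :=
  exists (T : finType) (e : rel T) (v : T) (cv ct : T -> nat) (pv pt sg : nat)
         (y : T) (t : seq T) (ds : seq (T * T)),
  [/\ nq_cactus n q e, gate_colouring e v cv ct N.+1 (N.+1 + d) pv pt sg,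
      [&& pv < N.+1, pt < N.+1 + d & sg < N.+1], fan e v y t ds &
      size t = N /\ size ds = d].

Lemma nq_cactus_irr n q (T : finType) (e : rel T) : nq_cactus n q e -> irreflexive e.
Proof. by case=> -[_ []]. Qed.

Lemma nq_cactus_point : nq_cactus 1 0 (fun _ _ : unit => false).
Proof.
split; last first.
- apply/eqP; rewrite cards_eq0; apply/eqP/setP => C; rewrite inE.
  apply/negP => /dicyclesP [x [c [/andP [+ _] _]]]; by case: c.
- by rewrite card_unit.
by split=> [[] []| |//]; [exact: connect0 | split].
Qed.

Lemma fan_cactus_base m : 1 < m -> fan_cactus (1 + m) 1 m 0.
Proof.
move=> m1; pose e (_ _ : unit) := false; pose c0 (_ : unit) := 0.
(* The reserved colours [1, 1, 2] are placeholders: they meet [gc_gate], and no dipath of the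
   one-point graph has an arc. *)
have col : gate_colouring e tt c0 c0 1 1 1 1 2.
  split=> // [[]|[]|[] []] //; exists [::]; split=> //.
have gcol : gate_colouring (@attach _ e tt m) (inl tt) (attach_col c0 S) (attach_col c0 S)
              m.+1 m.+1 m.-1.+1 m.-1.+1 1.
  by apply: (@attach_gate_colouring _ _ _ _ _ _ _ _ _ _ col m S S m.+1 m.+1) => // i j _ _ [].
have m1m : m.-1 < m by lia.
exists _, (@attach _ e tt m), (inl tt), (attach_col c0 S), (attach_col c0 S), m.-1.+1, m.-1.+1, 1.
exists (inr (Ordinal m1m)), (inl tt :: map inr (seg m 0 m.-1)), [::]; split.
- exact: (attach_nq_cactus tt m1 _ nq_cactus_point).
- by rewrite addn0; exact: gcol.
- lia.
- by split=> //; exact: (attach_vr e tt m1 (Ordinal m1m)).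
- by split=> //; rewrite /= size_map size_seg /=; lia.
Qed.

(** Both new vertices get fresh colours, the gate moves to the first of them, and the dipath from
    the gate grows by two arcs. *)
Lemma fan_cactus_plus n q N : fan_cactus n q N 0 -> fan_cactus (n + 2) q.+1 N.+2 0.
Proof.
case=> T [e [v [cv [ct [pv [pt [sg [y [t [ds]]]]]]]]]].
case=> nq col /and3P [hpv hpt hsg] [tv t0 _ _ _] [szt _].
rewrite addn0 in col hpt.
pose b i := N.+1 + i.
have szt' : size (map inr (seg 2 0 2) ++ map inl t : seq (T + 'I_2)) = N.+2.
  by rewrite size_cat !size_map size_seg // szt.
have inj : {in [pred i | i < 2] &, injective b} by move=> i j _ _; apply: addnI.
have gcol : gate_colouring (@attach _ e v 2) (inr ord0) (attach_col cv b) (attach_col ct b)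
              N.+3 N.+3 pv pt sg.
  have /and4P [_ _ _ sgpv] := gc_gate col.
  apply: (@attach_new_gate_colouring _ _ _ _ _ _ _ _ _ _ col 2 b b N.+3 N.+3) => //;
    rewrite ?eqxx /b //=; lia.
exists _, (@attach _ e v 2), (inr ord0), (attach_col cv b), (attach_col ct b), pv, pt, sg.
exists (inl y), (map inr (seg 2 0 2) ++ map inl t), [::]; split.
- by apply: attach_nq_cactus => //; apply: nq_cactus_irr nq.
- by rewrite addn0.
- lia.
- by split; rewrite ?szt' //; exact: (@attach_rl _ _ _ 2 isT y t ord0).
- by rewrite szt'.
Qed.

(** The gate moves to the vertex [1] opposite the old one. The vertex [2] reuses [pv] and [pt], and
    the colour [N.+1] of the vertex [0] just before the new gate is reserved next. Three vertices
    thus cost two colours of each kind. *)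
Lemma fan_cactus_square n q N : fan_cactus n q N 0 -> fan_cactus (n + 3) q.+1 N.+2 0.
Proof.
case=> T [e [v [cv [ct [pv [pt [sg [y [t [ds]]]]]]]]]].
case=> nq col /and3P [hpv hpt hsg] [tv t0 _ _ _] [szt _].
rewrite addn0 in col hpt.
pose b i := if i == 2 then pv else N.+1 + i.
pose a i := if i == 2 then pt else N.+1 + i.
have b_inj : {in [pred i | i < 3] &, injective b}.
  by move=> i j; rewrite !inE /b; do 2!case: eqP; lia.
have a_inj : {in [pred i | i < 3] &, injective a}.
  by move=> i j; rewrite !inE /a; do 2!case: eqP; lia.
have szt' : size (map inr (seg 3 1 3) ++ map inl t : seq (T + 'I_3)) = N.+2.
  by rewrite size_cat !size_map size_seg // szt.
pose g : 'I_3 := Ordinal (isT : 1 < 3).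
have gcol : gate_colouring (@attach _ e v 3) (inr g) (attach_col cv b) (attach_col ct a)
              N.+3 N.+3 N.+1 N.+1 sg.
{   have /and4P [_ _ _ sgpv] := gc_gate col.
  apply: (@attach_new_gate_colouring _ _ _ _ _ _ _ _ _ _ col 3 b a N.+3 N.+3) => //;
    rewrite /a /b ?leqnn ?orbT //=; try lia.
  all: by move=> i; have [->|i2] := eqVneq i 2; rewrite ?eqxx ?orbT //; lia. }
exists _, (@attach _ e v 3), (inr g), (attach_col cv b), (attach_col ct a), N.+1, N.+1, sg.
exists (inl y), (map inr (seg 3 1 3) ++ map inl t), [::]; split.
- by apply: attach_nq_cactus => //; apply: nq_cactus_irr nq.
- by rewrite addn0.
- lia.
- by split; rewrite ?szt' //; exact: (@attach_rl _ _ _ 3 isT y t g).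
- by rewrite szt'.
Qed.

(** The gate stays. The new vertices reuse the vertex colours [sg] and [pv], and the second one the
    tail colour [pt]; only the tail colour [N.+1 + d] of the first is new. The reserved colours
    survive for the next triangle. *)
Lemma fan_cactus_triangle n q N d : fan_cactus n q N d -> fan_cactus (n + 2) q.+1 N d.+1.
Proof.
case=> T [e [v [cv [ct [pv [pt [sg [y [t [ds]]]]]]]]]].
case=> nq col /and3P [hpv hpt hsg] [tv t0 ud H Q] [szt szd].
pose b i := if i == 0 then sg else pv.
pose a i := if i == 0 then N.+1 + d else pt.
have /and4P [_ _ _ sgpv] := gc_gate col.
have b_inj : {in [pred i | i < 2] &, injective b}.
  by move=> i j; rewrite !inE /b; do 2!case: eqP; lia.
have a_inj : {in [pred i | i < 2] &, injective a}.
  by move=> i j; rewrite !inE /a; do 2!case: eqP; lia.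
have gcol : gate_colouring (@attach _ e v 2) (inl v) (attach_col cv b) (attach_col ct a)
              N.+1 (N.+1 + d.+1) pv pt sg.
{   apply: (@attach_gate_colouring _ _ _ _ _ _ _ _ _ _ col 2 b a N.+1 (N.+1 + d.+1)) => //;
    rewrite /a /b //=; try lia.
  all: by move=> i; have [->|i2] := eqVneq i 0; rewrite ?eqxx ?orbT //; lia. }
pose f0 : 'I_2 := ord0; pose f1 : 'I_2 := ord_max.
pose h (z : T * T) : (T + 'I_2) * (T + 'I_2) := (inl z.1, inl z.2).
have h_inj : injective h by move=> [x x'] [z z'] [-> ->].
have inlt s : (inr s : T + 'I_2) \notin rcons (map inl t) (inl y).
  by rewrite -map_rcons inr_injl.
exists _, (@attach _ e v 2), (inl v), (attach_col cv b), (attach_col ct a), pv, pt, sg.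
exists (inl y), (map inl t), ((inr f0, inr f1) :: map h ds); split.
- by apply: attach_nq_cactus => //; apply: nq_cactus_irr nq.
- exact: gcol.
- lia.
- split.
  + exact: attach_ll.
  + by rewrite size_map szt -szt.
  + by rewrite /= map_inj_uniq // ud andbT; apply/negP => /mapP [].
  + move=> z; rewrite in_cons => /orP [/eqP -> |/mapP [z' /H [z1 z2 z3 z4 z5] ->]].
      by split; rewrite /= ?eqxx.
    by split; rewrite //= -map_rcons (mem_map (@inl_inj _ _)).
  + move=> z z'; rewrite !in_cons => /orP [/eqP -> |/mapP [z1 zd1 ->]] /orP [/eqP -> |/mapP [z2 zd2 ->]] //.
    * move=> _; have [_ z12 _ _ _] := H _ zd2; rewrite /= !inE /= !andbT.
      by apply: contraTneq z12 => -[->]; rewrite (nq_cactus_irr nq).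
    * move=> _; have [_ z12 _ _ _] := H _ zd1; rewrite /= !inE /= !andbT !orbF.
      by apply: contraTneq z12 => -[->]; rewrite (nq_cactus_irr nq).
    * move=> zz; have zz' : z1 != z2 by apply: contraNneq zz => ->.
      have := Q _ _ zd1 zd2 zz'.
      by rewrite -(map_inj_uniq (@inl_inj T 'I_2)).
- by rewrite /= !size_map szt szd.
Qed.

Lemma fan_cactus_exists m a s d : 1 < m ->
  fan_cactus (1 + m + 2 * a + 3 * s + 2 * d) (1 + a + s + d) (m + 2 * a + 2 * s) d.
Proof.
move=> m1; elim: d => [|d IHd]; last first.
  have := fan_cactus_triangle IHd.
  by congr fan_cactus; lia.
elim: s => [|s IHs]; last by have := fan_cactus_square IHs; congr fan_cactus; lia.
elim: a => [|a IHa]; last by have := fan_cactus_plus IHa; congr fan_cactus; lia.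
by have := fan_cactus_base m1; congr fan_cactus; lia.
Qed.

(** * Exact values and the choice of parameters *)

Theorem cactus_with_rvc_trc n q m a s d : 1 < m -> 0 < d ->
  n = 1 + m + 2 * a + 3 * s + 2 * d -> q = 1 + a + s + d ->
  exists (T : finType) (e : rel T),
    [/\ nq_cactus n q e,
        rvc e = 1 + m + 2 * a + 2 * s & trc e = 2 * (1 + m + 2 * a + 2 * s) + d].
Proof.
move=> m1 d0 -> ->; have [T [e [v [cv [ct [pv [pt [sg [y [t [ds]]]]]]]]]]] := fan_cactus_exists a s d m1.
case=> nq col _ fan_ds [szt szd]; exists T, e.
have [cactus_e _ _] := nq; have sc := cactus_strong cactus_e.
have ds0 : 0 < size ds by rewrite szd.
split=> //.
- have [rP rmin] := rvc_minimal sc.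
  have lo := fan_rvc cactus_e fan_ds ds0 rP.
  suff /rmin hi : rvc_colourable e (m + 2 * a + 2 * s).+1 by lia.
  apply: (rvc_colourable_nat (gc_cv col)) => x z; have [u gu] := gc_path col x z.
  have [p dp pu] := tpath_dipath (gp_path gu); exists p => //.
  by rewrite /internal pu (gp_cv gu).
have [rP rmin] := trc_minimal sc.
have lo := fan_trc cactus_e fan_ds ds0 rP.
suff /rmin hi : trc_colourable e ((m + 2 * a + 2 * s).+1 + ((m + 2 * a + 2 * s).+1 + d)) by lia.
apply: (trc_colourable_nat (gc_cv col) (gc_ct col)) => x z; have [u gu] := gc_path col x z.
have [p dp pu] := tpath_dipath (gp_path gu); exists p => //.
by rewrite /internal pu (gp_cv gu) (gp_ct gu).
Qed.

Theorem theorem29 (q : nat) (hq : 2 <= q) :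
  [/\ forall k n : nat, 2 <= k <= 2 * q - 2 ->
        (~~ odd k -> 2 * q + 1 <= n) ->
        (odd k -> 2 * q + 2 <= n) ->
        exists (T : finType) (e : rel T),
          nq_cactus n q e /\ rvc e = n - 2 * q + k,
      forall k n : nat, 3 <= k <= 3 * q - 3 -> k <> 3 * q - 4 ->
        (k = 0 %[mod 3] -> 2 * q + 1 <= n) ->
        (k = 1 %[mod 3] -> 2 * q + 2 <= n) ->
        (k = 2 %[mod 3] -> 2 * q + 3 <= n) ->
        exists (T : finType) (e : rel T),
          nq_cactus n q e /\ trc e = 2 * n - 3 * q + k
    & forall (n : nat) (T : finType) (e : rel T),
        nq_cactus n q e -> trc e <> 2 * n - 4].
Proof.
split.
(* With [s] 4-cycles, [d] final triangles, [m = n - 2q + 1 - s] and [a = q - 1 - s - d], the value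
   of [rvc] is [n - s - 2d]. So [2d + s = 2q - k] is needed, and [s] is taken as the parity of
   [k]. *)
- move=> k n kq even_n odd_n; pose s : nat := odd k.
  pose d := (2 * q - k - s)./2.
  have sE : n >= 2 * q + 1 + s by rewrite /s; case: (odd k) even_n odd_n => /= H1 H2; [have := H2 isT | have := H1 isT]; lia.
  have dE : 2 * d + s + k = 2 * q.
    have := odd_double_half k; have := odd_double_half (2 * q - k - s); rewrite -/d -/s.
    have -> : odd (2 * q - k - s) = false.
      rewrite /s !oddB ?oddM //=; first by case: (odd k).
        by case: (odd k) kq => /=; lia.
      by lia.
    by rewrite /s; case: (odd k) kq => /=; lia.
  have sk : s <= 1 by rewrite /s; case: (odd k).
  have m1 : 1 < n - 2 * q + 1 - s by lia.
  have d0 : 0 < d by lia.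
  have [|| T [e [nq rE _]]] := @cactus_with_rvc_trc n q _ (q - 1 - s - d) s d m1 d0; try lia.
  by exists T, e; split=> //; rewrite rE; lia.
(* With the same [m] and [a], the value of [trc] is [2n - 2s - 3d], so [3d + 2s = 3q - k] and [s] is
   the residue of [k] modulo 3. For [k = 3q - 4] this would give [s = 2] and [d = 0]. *)
- move=> k n kq kq4 h0 h1 h2; pose s := k %% 3.
  have sE : n >= 2 * q + 1 + s.
    rewrite /s; have : k %% 3 < 3 by rewrite ltn_mod.
    by case: (k %% 3) (h0) (h1) (h2) => [|[|[|]]] //; rewrite !modn_small //; lia.
  pose d := q - (k + 2 * s) %/ 3.
  have dE : 3 * d + 2 * s + k = 3 * q by rewrite /d /s; lia.
  have m1 : 1 < n - 2 * q + 1 - s by lia.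
  have d0 : 0 < d by lia.
  have [|| T [e [nq _ rE]]] := @cactus_with_rvc_trc n q _ (q - 1 - s - d) s d m1 d0; try lia.
  by exists T, e; split=> //; rewrite rE; lia.
- move=> n T e [ce <- qE]; apply: trc_neq => //; by rewrite qE.
Qed.
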